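(* Let $X_{0-}$ be a real random variable with $\mathbb{E}|X_{0-}|<\infty$. For $x\in\mathbb{R}$, let $\underline{\Lambda}^x$ denote the minimal solution to the McKean--Vlasov equation (stated in the context) with initial condition $X_{0-}+x$. Then the map $x\mapsto\underline{\Lambda}^x$ from $\mathbb{R}$ to $(D([-1,\infty)),\mathrm{M1})$ is continuous at $x=0$ if and only if the initial condition $X_{0-}$ admits a unique physical solution to the McKean--Vlasov equation.
   Context: Fix $\alpha>0$. For an interval $I$, $D(I)$ is the space of càdlàg functions $I\to\mathbb{R}$. Elements $f$ of $D([0,\infty))$ carry a prescribed value $f_{0-}=f(0-)$, so a jump at time $0$ is allowed. Let $$M=\{\ell\in D([0,\infty)):\ \ell_{0-}=0,\ \ell\text{ is increasing (non-decreasing)}\}.$$ McKean--Vlasov equation: given an initial condition $X_{0-}$ (a real random variable) and a Brownian motion $B$ (started at $0$) independent of $X_{0-}$, a solution with initial data $X_{0-}$ is a function $\Lambda\in M$ such that $$X_t=X_{0-}+B_t-\Lambda_t\ (t\ge0),\qquad \tau=\inf\{t\ge0:X_t\le0\},\qquad \Lambda_t=\alpha\,\mathbb{P}(\tau\le t)\ (t\ge 0).$$ At $t=0$, $X_{t-}$ means the initial condition $X_{0-}$ and $\Lambda_{0-}=0$. A solution $\Lambda\in M$ is called physical if $\Lambda_{t}-\Lambda_{t-}=\inf\{x>0:\alpha\,\mathbb{P}(\tau\ge t,\ X_{t-}\in(0,x])<x\}$ at all $t\ge0$. Minimal solution: for $\ell\in M$ put $X^\ell_t=X_{0-}+B_t-\ell_t$,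 $\tau^\ell=\inf\{t\ge0:X^\ell_t\le0\}$ and $\Gamma[\ell;X_{0-}]_t=\alpha\,\mathbb{P}(\tau^\ell\le t)$, $t\ge0$; let $\Gamma^n[\,\cdot\,;X_{0-}]$ be the $n$-fold iterate of $\Gamma[\,\cdot\,;X_{0-}]$. The minimal solution with initial data $X_{0-}$ is $\underline\Lambda=\lim_{n\to\infty}\Gamma^n[0;X_{0-}]$ (limit in the M1 topology described below). It is known to be a solution, and it is equivalently characterized as the unique solution $\underline\Lambda\in M$ with $\underline\Lambda_t\le\Lambda_t$ for all $t\ge0$ and every solution $\Lambda\in M$ with the same initial data. When $\mathbb{E}|X_{0-}|<\infty$, it is known that the minimal solution is physical. Topology: every $f\in D([0,\infty))$ is regarded as an element of $D([-1,\infty))$ by setting $f(x)=f(0-)$ for $x\in[-1,0)$. M1 denotes the Skorokhod M1 topology. $f^n\to f$ in $(D([-1,\infty)),\mathrm{M1})$ means that there is a sequence $T_N\nearrow\infty$ such that $f^n\to f$ in $(D([-1,T_N]),\mathrm{M1})$ for all $N$. For non-decreasing functions, convergence in $(D([-1,T]),\mathrm{M1})$ is equivalent to $f^n(t)\to f(t)$ for all $t$ in a dense subset of $[-1,T]$ containing $-1$ and $T$.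
   Formalization: In the definition of physical solution, at t=0 the event also counts particles with X_{0-} ≤ 0; as printed, no solution is physical when P(X_{0-} ≤ 0)>0 (e.g. X_{0-} = −1, where the map is continuous at 0). For X_{0-} > 0 a.s. nothing changes. *)

(* Defs.v *)
From mathcomp Require Import all_boot all_order all_algebra.
From mathcomp Require Import all_classical all_reals all_analysis.

Set Implicit Arguments.
Unset Strict Implicit.
Unset Printing Implicit Defensive.

Import Order.TTheory GRing.Theory Num.Theory.
Import numFieldNormedType.Exports.

Local Open Scope classical_set_scope.
Local Open Scope ring_scope.

(** * Càdlàg functions

    An element [f] of D([0, oo)) with prescribed value f(0-) is represented by
    a total function [f : R -> R] that is constant, equal to f(0-), on the
    negative half-line. Its restriction to [-1, oo) is the associated element
    of D([-1, oo)), and two elements are equal iff the functions are. *)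

Definition leftlim (R : realType) (f : R -> R) (t : R) : R :=
  lim (f s @[s --> t^'-]).

Definition Dspace (R : realType) : set (R -> R) :=
  [set f : R -> R | [/\ right_continuous f,
    (forall t : R, cvg (f s @[s --> t^'-])) &
    (forall t : R, t < 0 -> f t = leftlim f 0)]].

Definition Mspace (R : realType) : set (R -> R) :=
  [set l : R -> R | [/\ Dspace l, leftlim l 0 = 0 & {homo l : s t / s <= t}]].

(** * The Skorokhod M1 topology *)

(* On D([a, b]) the left limit at [a] is by convention the value at [a]. *)
Definition M1_leftlim (R : realType) (a : R) (f : R -> R) (t : R) : R :=
  if t == a then f a else leftlim f t.

Definition completed_graph (R : realType) (a b : R) (f : R -> R) :
    set (R * R) :=
  [set p | a <= p.1 <= b /\
     exists2 c : R, 0 <= c <= 1 &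
       p.2 = c * M1_leftlim a f p.1 + (1 - c) * f p.1].

Definition graph_le (R : realType) (a : R) (f : R -> R) (p q : R * R) : Prop :=
  p.1 < q.1 \/
  (p.1 = q.1 /\
   `|M1_leftlim a f p.1 - p.2| <= `|M1_leftlim a f q.1 - q.2|).

Definition M1_parametrization (R : realType) (a b : R) (f : R -> R)
    (r u : R -> R) : Prop :=
  [/\ {within `[0, 1], continuous r},
      {within `[0, 1], continuous u},
      [set (r s, u s) | s in `[0, 1]] = completed_graph a b f &
      forall s1 s2 : R, 0 <= s1 -> s1 <= s2 -> s2 <= 1 ->
        graph_le a f (r s1, u s1) (r s2, u s2)].

Definition sup_dist01 (R : realType) (u v : R -> R) : \bar R :=
  ereal_sup [set (`|u s - v s|)%:E | s in `[0, 1]].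

Definition M1_dist (R : realType) (a b : R) (f g : R -> R) : \bar R :=
  ereal_inf [set e | exists r1 u1 r2 u2,
    [/\ M1_parametrization a b f r1 u1, M1_parametrization a b g r2 u2 &
        e = maxe (sup_dist01 r1 r2) (sup_dist01 u1 u2)]].

(* Convergence in (D([-1, oo)), M1): convergence in (D([-1, T N]), M1) for all
   N, along some sequence [T] increasing to infinity. *)
Definition M1_cvg (R : realType) (f : nat -> R -> R) (g : R -> R) : Prop :=
  exists T : nat -> R,
    [/\ forall N, -1 < T N, nondecreasing_seq T, T @ \oo --> +oo &
        forall N, M1_dist (-1) (T N) (f n) g @[n --> \oo] --> 0%E].

(* Continuity for the M1 topology on the target, which is metrizable. *)
Definition M1_continuous_at (R : realType) (F : R -> R -> R) (x0 : R) : Prop :=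
  forall x : nat -> R, x @ \oo --> x0 -> M1_cvg (fun n => F (x n)) (F x0).

(** * Brownian motion *)

Definition increment (R : realType) (T : Type) (B : R -> T -> R) (s t : R)
    (w : T) : R := B t w - B s w.

(* Only the values [B t] with [0 <= t] matter. *)
Record brownian_motion (R : realType) (d : measure_display)
    (T : measurableType d) (P : probability T R) (B : R -> {RV P >-> R}) :
    Prop := BrownianMotion {
  brownian_start : forall w, B 0 w = 0 ;
  brownian_continuous : forall w,
    {within `[0, +oo[, continuous (fun t : R => B t w : R)} ;
  (* the second parameter of [normal_prob] is the standard deviation *)
  brownian_gaussian : forall s t : R, 0 <= s -> s < t ->
    forall A : set R, measurable A ->
      P (increment B s t @^-1` A)
      = normal_prob 0 (Num.sqrt (t - s)) A ;
  brownian_independent_increments :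
    forall (n : nat) (t : nat -> R) (A : nat -> set R),
      0 <= t 0%N -> nondecreasing_seq t -> (forall i, measurable (A i)) ->
      P (\bigcap_(i in `I_n) (increment B (t i) (t i.+1) @^-1` A i))
      = (\prod_(i < n) P (increment B (t i) (t i.+1) @^-1` A i))%E
}.

(* The sigma-algebra generated by [B t], [0 <= t]. *)
Definition process_sigma_algebra (R : realType) (d : measure_display)
    (T : measurableType d) (B : R -> T -> R) : set_system T :=
  <<s [set E | exists2 t : R, 0 <= t &
         exists2 A : set R, measurable A & E = B t @^-1` A] >>.

Definition independent_of_process (R : realType) (d : measure_display)
    (T : measurableType d) (P : probability T R) (X0 : T -> R)
    (B : R -> T -> R) : Prop :=
  forall (A : set R) (E : set T),
    measurable A -> process_sigma_algebra B E ->
    P (X0 @^-1` A `&` E) = (P (X0 @^-1` A) * P E)%E.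

(** * The McKean--Vlasov equation *)

(* [state X0 B l t w] is X^l_t = X_{0-} + B_t - l_t for t >= 0. For t < 0 and
   [l] in [Mspace] it is X_{0-}, so that its left limit at 0 is X_{0-}. *)
Definition state (R : realType) (T : Type) (X0 : T -> R) (B : R -> T -> R)
    (l : R -> R) (t : R) (w : T) : R :=
  X0 w + B (Num.max t 0) w - l t.

Definition hitting_time (R : realType) (T : Type) (X0 : T -> R)
    (B : R -> T -> R) (l : R -> R) (w : T) : \bar R :=
  ereal_inf [set t%:E | t in [set t | 0 <= t /\ state X0 B l t w <= 0]].

(* This vanishes for t < 0, since hitting times are nonnegative: the prescribed
   value of Gamma[l] at 0- is 0. *)
Definition Gamma (R : realType) (d : measure_display) (T : measurableType d)
    (P : probability T R) (alpha : R) (B : R -> T -> R) (X0 : T -> R)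
    (l : R -> R) (t : R) : R :=
  alpha * fine (P [set w | (hitting_time X0 B l w <= t%:E)%E]).

Definition solution (R : realType) (d : measure_display) (T : measurableType d)
    (P : probability T R) (alpha : R) (B : R -> T -> R) (X0 : T -> R)
    (L : R -> R) : Prop :=
  Mspace L /\ forall t : R, 0 <= t -> L t = Gamma P alpha B X0 L t.

(* The event is {tau >= t, X_{t-} in (0, x]}, except that at t = 0 the particles
   with X_{0-} <= 0 are counted too. As L_{0-} = 0 and L_0 >= alpha P(X_{0-} <= 0)
   for every solution, without them no solution would be physical as soon as
   P(X_{0-} <= 0) > 0. If X_{0-} > 0 almost surely, they are negligible. *)
Definition physical_solution (R : realType) (d : measure_display)
    (T : measurableType d) (P : probability T R) (alpha : R) (B : R -> T -> R)
    (X0 : T -> R) (L : R -> R) : Prop :=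
  solution P alpha B X0 L /\
  forall t : R, 0 <= t ->
    L t - leftlim L t =
    inf [set x : R | 0 < x /\
      alpha * fine (P [set w |
        (t%:E <= hitting_time X0 B L w)%E /\
        (0 < leftlim (fun s => state X0 B L s w) t <= x \/
         t = 0 /\ X0 w <= 0)]) < x].

(* The M1 limit of Gamma^n[0; X_{0-}]; the default value of [xget] is
   irrelevant, as this limit exists, and it is unique in [Dspace]. *)
Definition minimal_solution (R : realType) (d : measure_display)
    (T : measurableType d) (P : probability T R) (alpha : R) (B : R -> T -> R)
    (X0 : T -> R) : R -> R :=
  xget (cst 0) [set L | Dspace L /\
    M1_cvg (fun n => iter n (Gamma P alpha B X0) (cst 0)) L].

(* Main.v *)
Require Import Defs.
From HB Require Import structures.
From mathcomp Require Import all_boot all_order all_algebra.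
From mathcomp Require Import all_classical all_reals all_analysis.
From mathcomp Require Import measurable_realfun lra.

Set Implicit Arguments.
Unset Strict Implicit.
Unset Printing Implicit Defensive.

Import Order.TTheory GRing.Theory Num.Theory.
Import numFieldNormedType.Exports.
Local Open Scope classical_set_scope.
Local Open Scope ring_scope.

(** Write [L x] for the minimal solution with initial condition [X0 + x]. It is
    the least supersolution of the fixed point equation, hence nonincreasing in
    [x]. From the right there is always continuity: by lower semicontinuity of
    hitting probabilities (a Brownian particle that touches a nondecreasing
    boundary crosses it), the limit of [L x] as [x] decreases to 0 is a
    supersolution, hence not smaller than [L 0]. From the left, compactness
    shows that [K = inf_n L (- 1/n)] is a solution. Both [L 0] and [K] are
    physical. Their jumps are not too large, because otherwise the boundaries
    [L (- 1/n)] could be replaced by smaller supersolutions around the jump.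
    They are not too small, because a boundary that leaves a density of at least
    [1 / alpha] in front of itself would, by the symmetry of the Brownian
    increments, have to move by more than it does. Finally, a solution with
    jumps of physical size stays below every solution started from [X0 - e], so
    every physical solution lies between [L 0] and [K]: continuity at 0 means
    [L 0 = K], which is uniqueness of the physical solution. *)

(** * Nondecreasing right-continuous functions *)

(** Hitting probabilities behave differently in the two directions. When boundaries decrease to
    their limit, hits survive by compactness of the time interval. When they increase, a particle
    that only touches the limit may never meet an approximation, so touching without crossing must
    be null. This is obtained without stopping times: at a deterministic time q > 0, the increment
    over [0, q] is independent of X0 and of the later increments, and its law has no atom; only
    touching at time 0 remains, which needs the behaviour of paths near 0. The initial law may have
    atoms, so time 0 is treated apart throughout. Supersolutions make the replacement arguments
    possible: a spliced boundary only has to satisfy an inequality, and may be chosen crudely at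
    late times. Comparing a physical solution with a competitor needs the head start e > 0: it makes
    particles exposed to slightly more than the competitor's jump count as hit, and it absorbs the
    small rise that right continuity allows afterwards. *)

Section monotone_functions.
Context {R : realType}.
Implicit Types (l f g : R -> R) (s t e : R).

(** For a nondecreasing function, control of the single value at t + d controls the whole interval
    [t, t + d]; this one-point form is therefore equivalent to right continuity. *)
Definition rcnd l :=
  {homo l : s t / s <= t} /\
  forall t e, 0 < e -> exists2 d, 0 < d & l (t + d) < l t + e.

Lemma homo_leW l s t : {homo l : s t / s <= t} -> s <= t -> l s <= l t.
Proof. by move=> ml; exact: ml. Qed.

Lemma rcnd_right_continuous l : rcnd l -> right_continuous l.
Proof.
move=> [ml rl] t; apply/cvgrPdist_lt => e e0.
have [d d0 ld] := rl t e e0.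
near=> u; have tu : t < u by near: u; exact: nbhs_right_gt.
have ud : u < t + d by near: u; apply: nbhs_right_lt; rewrite ltrDl.
have := ml _ _ (ltW tu); have := ml _ _ (ltW ud).
by move=> h1 h2; rewrite distrC ger0_norm ?subr_ge0//; lra.
Unshelve. all: by end_near. Qed.

Lemma right_continuous_rcnd l :
  {homo l : s t / s <= t} -> right_continuous l -> rcnd l.
Proof.
move=> ml rl; split=> // t e e0.
have /cvgrPdist_lt/(_ e e0)[d /= d0 H] := rl t.
exists (d / 2); first by rewrite divr_gt0.
have := H (t + d / 2); rewrite /= opprD addrA subrr sub0r normrN.
rewrite ger0_norm ?divr_ge0 ?(ltW d0)//.
rewrite distrC ltr_norml => /(_ ltac:(lra) ltac:(lra)) /andP[_]; lra.
Qed.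

Lemma nondecreasing_cvg_left l t : {homo l : s t / s <= t} ->
  cvg (l s @[s --> t^'-]).
Proof.
move=> ml; apply: nondecreasing_at_left_is_cvgr.
  by near=> x => y z _ _; exact: ml.
near=> x; exists (l t) => _ [y /= + <-]; rewrite in_itv/= => /andP[_ yt].
exact/ml/ltW.
Unshelve. all: by end_near. Qed.

Lemma leftlim_ge l s t : {homo l : s t / s <= t} -> s < t ->
  l s <= leftlim l t.
Proof.
move=> ml st; apply: limr_ge; first exact: nondecreasing_cvg_left.
near=> u; apply/ml/ltW; near: u; exact: nbhs_left_gt.
Unshelve. all: by end_near. Qed.

Lemma leftlim_le l t c : {homo l : s t / s <= t} ->
  (forall s, s < t -> l s <= c) -> leftlim l t <= c.
Proof.
move=> ml lc; apply: limr_le; first exact: nondecreasing_cvg_left.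
near=> u; apply: lc; near: u; exact: nbhs_left_lt.
Unshelve. all: by end_near. Qed.

Lemma leftlim_le_at l t : {homo l : s t / s <= t} -> leftlim l t <= l t.
Proof. by move=> ml; apply: leftlim_le => // s /ltW; exact: ml. Qed.

Lemma leftlim_approx l t e : {homo l : s t / s <= t} -> 0 < e ->
  exists2 s, s < t & leftlim l t - e < l s.
Proof.
move=> ml e0; apply: contrapT => /forall2NP H.
suff : leftlim l t <= leftlim l t - e by lra.
apply: leftlim_le => // s st; case: (H s) => // /negP; by rewrite -leNgt.
Qed.

Lemma rcnd_le_of_gt l t c : rcnd l -> (forall s, t < s -> c <= l s) -> c <= l t.
Proof.
move=> [ml rl] H; rewrite leNgt; apply/negP => lc.
have [d d0 ld] := rl t (c - l t) ltac:(lra).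
have := H (t + d) ltac:(lra); lra.
Qed.

Lemma MspaceP l : Mspace l <-> rcnd l /\ forall t, t < 0 -> l t = 0.
Proof.
split.
  move=> [[rl cl l0] ll ml]; split; first exact: right_continuous_rcnd.
  by move=> t /l0 ->.
move=> [rl l0]; have ml := rl.1.
have L0 : leftlim l 0 = 0.
  apply/eqP; rewrite eq_le leftlim_le//=; last by move=> s /l0 ->.
  by have := leftlim_ge ml (ltrN10 R); rewrite (l0 _ (ltrN10 R)).
split => //; split => //.
- exact: rcnd_right_continuous.
- by move=> t; exact: nondecreasing_cvg_left.
- by move=> t t0; rewrite L0 l0.
Qed.

Lemma Mspace_rcnd l : Mspace l -> rcnd l. Proof. by move=> /MspaceP[]. Qed.
Lemma Mspace_homo l : Mspace l -> {homo l : s t / s <= t}.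
Proof. by move=> []. Qed.
Lemma Mspace_lt0 l t : Mspace l -> t < 0 -> l t = 0.
Proof. by move=> /MspaceP[_]; exact. Qed.
Lemma Mspace_ge0 l t : Mspace l -> 0 <= l t.
Proof.
move=> Ml; have [t0|t0] := ltP t 0; first by rewrite (Mspace_lt0 Ml).
have N1 : -1 < 0 :> R by lra.
rewrite -(Mspace_lt0 Ml N1); apply: (Mspace_homo Ml); lra.
Qed.

Lemma rcnd_cst (c : R) : rcnd (cst c).
Proof.
split=> [s t _|t e e0]; first exact: lexx.
by exists 1 => //; rewrite /cst ltrDl.
Qed.

Lemma Mspace_cst0 : Mspace (cst 0 : R -> R).
Proof. by apply/MspaceP; split => //; exact: rcnd_cst. Qed.

Definition left_continuous_at l t :=
  forall e, 0 < e -> exists2 s, s < t & l t - e < l s.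

(* A monotone function has countably many discontinuities. *)
Lemma exists_left_continuous_at l (a b : R) : rcnd l -> a < b ->
  exists2 t, a < t < b & left_continuous_at l t.
Proof.
move=> rl ab; have ml := rl.1; apply: contrapT => /forall2NP H.
have cD := @discontinuity_countable R a b l (fun x y _ _ => @ml x y).
have : lebesgue_measure (`]a, b[ : set R) = 0%E.
  apply: countable_lebesgue_measure0; apply: sub_countable cD.
  apply: subset_card_le => t /=; rewrite in_itv/= => tab; split => //.
  have lr : lim (l x @[x --> t^'+]) = l t.
    by apply/cvg_lim => //; exact: rcnd_right_continuous.
  split.
  - exact: nondecreasing_cvg_left.
  - by apply/cvg_ex; exists (l t); exact: rcnd_right_continuous.
  - rewrite lr; apply/eqP => E; case: (H t) => //; apply.
    by move=> e e0; rewrite -E; exact: leftlim_approx.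
rewrite lebesgue_measure_itv/= lte_fin ab -EFinD => -[] /eqP.
by rewrite subr_eq0 => /eqP ba; rewrite ba ltxx in ab.
Qed.

End monotone_functions.

(** * M1 convergence of monotone functions *)

Section M1.
Context {R : realType}.
Implicit Types (l f g : R -> R) (a b s t e : R).

(** An infimum is approached from above, so closedness under limits from the right is enough. This
    is exactly what right-continuous boundaries provide. *)
Lemma inf_attained (S : set R) : S !=set0 -> has_lbound S ->
  (forall t, (forall d, 0 < d -> exists2 u, t <= u < t + d & S u) -> S t) ->
  S (inf S).
Proof.
move=> S0 lS; apply => d d0.
have hS : has_inf S by split.
have [u Su ud] := inf_adherent d0 hS.
by exists u => //; rewrite ud andbT; exact: ge_inf.
Qed.

(* The first time at which the curve [t |-> t + l t] reaches level [s]: the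
   completed graph of a nondecreasing [l] is parametrized by the sum of the
   two coordinates. *)
Definition graph_time l a s := inf [set t | a <= t /\ s <= t + l t].

Lemma graph_time_spec l a b s : rcnd l -> a <= b -> s <= b + l b ->
  [/\ a <= graph_time l a s, graph_time l a s <= b,
      s <= graph_time l a s + l (graph_time l a s) &
      forall t, a <= t -> s <= t + l t -> graph_time l a s <= t].
Proof.
move=> [ml rl] ab sb; set r := graph_time _ _ _; pose S := [set t | a <= t /\ s <= t + l t].
have lS : has_lbound S by exists a => t [].
have Sr : forall t, S t -> r <= t by move=> t St; exact: ge_inf.
have [] : S r.
  apply: inf_attained => //; first by exists b.
  move=> t H; split.
    rewrite leNgt; apply/negP => ta.
    have [u /andP[tu ud] [au _]] := H (a - t) ltac:(lra); lra.
  rewrite leNgt; apply/negP => ta.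
  have [d d0 ld] := rl t ((s - (t + l t)) / 2) ltac:(lra).
  have [|u /andP[tu ud] [au su]] := H (Num.min d ((s - (t + l t)) / 2)).
    by rewrite lt_min d0/=; lra.
  have u1 : u < t + d by apply: lt_le_trans ud _; rewrite lerD2l ge_min lexx.
  have u2 : u < t + (s - (t + l t)) / 2.
    by apply: lt_le_trans ud _; rewrite lerD2l ge_min lexx orbT.
  have := ml _ _ (ltW u1); lra.
move=> ar sr; split => //; first exact: Sr.
by move=> t at_ st; exact: Sr.
Qed.

Lemma graph_time_left l a b s : rcnd l -> a <= b -> a + l a <= s ->
  s <= b + l b ->
  M1_leftlim a l (graph_time l a s) <= s - graph_time l a s.
Proof.
move=> rl ab as_ sb; have [] := graph_time_spec rl ab sb.
set r := graph_time _ _ _ => ar rb sr rmin.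
have ml := rl.1; rewrite /M1_leftlim; case: eqP => [->|/eqP ra]; first lra.
have {}ra : a < r by rewrite lt_def ra.
apply: leftlim_le => // v vr; rewrite leNgt; apply/negP => H.
pose w := Num.max (Num.max a v) (s - l v).
have vw : v <= w by rewrite !le_max lexx orbT.
have aw : a <= w by rewrite !le_max lexx.
have wr : w < r by rewrite !gt_max ra vr/=; lra.
have sw : s - l v <= w by rewrite le_max lexx orbT.
have := rmin w aw; have := ml _ _ vw; lra.
Qed.

(** A point of the completed graph is recovered from the sum of its coordinates, which makes the
    parametrization by level onto. *)
Lemma graph_time_inv l a b t y : rcnd l -> a <= t <= b ->
  M1_leftlim a l t <= y <= l t ->
  [/\ a + l a <= t + y, t + y <= b + l b & graph_time l a (t + y) = t].
Proof.
move=> rl /andP[at_ tb] /andP[ly yl]; have ml := rl.1.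
have ay : l a <= y.
  move: ly; rewrite /M1_leftlim; case: eqP => // /eqP ta.
  by apply: le_trans; apply: leftlim_ge => //; rewrite lt_def ta.
have sb : t + y <= b + l b by have := ml _ _ tb; lra.
have ab := le_trans at_ tb.
have [ar rb sr rmin] := graph_time_spec rl ab sb.
split => //; first lra.
apply/eqP; rewrite eq_le rmin//=; last lra.
rewrite leNgt; apply/negP => rt; move: ly; rewrite /M1_leftlim.
case: eqP => [ta|_ ly]; first by move: rt ar; rewrite ta; lra.
have := leftlim_ge ml rt; lra.
Qed.

(** As l does not decrease, time advances at most as fast as the level. Hence both the time r and
    the height s - r are nondecreasing and 1-Lipschitz in the level s. *)
Lemma graph_time_lip l a b s s' : rcnd l -> a <= b -> a + l a <= s ->
  s <= s' -> s' <= b + l b ->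
  0 <= graph_time l a s' - graph_time l a s <= s' - s.
Proof.
move=> rl ab as_ ss' sb'; have ml := rl.1.
have sb : s <= b + l b by lra.
have as' : a + l a <= s' by lra.
have [ar rb sr rmin] := graph_time_spec rl ab sb.
have [ar' rb' sr' rmin'] := graph_time_spec rl ab sb'.
have := graph_time_left rl ab as' sb'.
set r := graph_time _ _ s in ar rb sr rmin *.
set r' := graph_time _ _ s' in ar' rb' sr' rmin' * => L.
have rr' : r <= r' by apply: rmin => //; lra.
rewrite subr_ge0 rr'/=; case: (ltgtP r r') rr' => // [rr' _|-> _]; last lra.
move: L; rewrite /M1_leftlim gt_eqF; last lra.
have := leftlim_ge ml rr'; lra.
Qed.

(** If the time for g were later than this bound, g would just before it be at least g (r + e) >= f
    r - e, with r the time for f, so its curve would already have passed level s'. *)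
Lemma graph_time_close f g a b s s' e : rcnd f -> rcnd g -> a <= b -> 0 <= e ->
  (forall t, a <= t <= b -> f t <= g (t + e) + e) ->
  s <= b + f b -> a + g a <= s' -> s' <= b + g b ->
  graph_time g a s' <= graph_time f a s + e + `|s - s'|.
Proof.
move=> rf rg ab e0 fg sb as' sb'.
have [ar rb sr rmin] := graph_time_spec rf ab sb.
have [ar' rb' sr' rmin'] := graph_time_spec rg ab sb'.
have := graph_time_left rg ab as' sb'.
set r := graph_time f _ s in ar rb sr rmin *.
set r' := graph_time _ _ s' in ar' rb' sr' rmin' * => L.
have N := normr_ge0 (s - s'); have := ler_norm (s' - s); rewrite distrC => N'.
rewrite leNgt; apply/negP => H.
move: L; rewrite /M1_leftlim gt_eqF; last lra.
have := @leftlim_ge _ g (r + e) r' rg.1 ltac:(lra).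
have := fg r ltac:(lra); lra.
Qed.

(** Clamping makes the parametrizations Lipschitz on the whole line, so that continuity within
    [0, 1] follows by restriction. *)
Definition clamp01 s : R := Num.max 0 (Num.min 1 s).

Lemma clamp01_itv s : 0 <= clamp01 s <= 1.
Proof. by rewrite /clamp01 le_max lexx/= ge_max ler01 ge_min lexx. Qed.

Lemma clamp01_id s : 0 <= s <= 1 -> clamp01 s = s.
Proof. by move=> /andP[s0 s1]; rewrite /clamp01 (min_idPr _)// (max_idPr _). Qed.

Lemma clamp01_lip s t : s <= t -> 0 <= clamp01 t - clamp01 s <= t - s.
Proof.
move=> st; rewrite /clamp01 /Num.max /Num.min.
by do !case: ifPn; rewrite -?leNgt => *; lra.
Qed.

Lemma nondecreasing_lip_continuous (h : R -> R) (k : R) :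
  (forall s t, s <= t -> `|h t - h s| <= k * (t - s)) -> continuous h.
Proof.
move=> H t; apply/cvgrPdist_le => e e0.
have k1 : 0 < `|k| + 1 by have := normr_ge0 k; lra.
have d0 : 0 < e / (`|k| + 1) by rewrite divr_gt0.
have B : forall u v, u <= v -> v - u <= e / (`|k| + 1) -> `|h v - h u| <= e.
  move=> u v uv vu; apply: le_trans (H _ _ uv) _.
  apply: (@le_trans _ _ ((`|k| + 1) * (e / (`|k| + 1)))); last first.
    by rewrite mulrCA divff ?mulr1// gt_eqF.
  apply: ler_pM => //; rewrite ?subr_ge0//; last 1 first.
    by have := ler_norm k; lra.
  rewrite leNgt; apply/negP => k0.
  have := H 0 1 ler01; rewrite subr0 mulr1.
  by have := normr_ge0 (h 1 - h 0); lra.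
near=> u; have : `|t - u| < e / (`|k| + 1).
  near: u; apply: cvgr_dist_lt => //; exact: cvg_id.
rewrite ltr_norml => /andP[u1 u2].
have [ut|ut] := leP u t; first by apply: B => //; lra.
rewrite distrC; apply: B; lra.
Unshelve. all: by end_near. Qed.

Definition graph_level l a b s := (a + l a) + clamp01 s * ((b + l b) - (a + l a)).
Definition graph_r l a b s := graph_time l a (graph_level l a b s).
Definition graph_u l a b s := graph_level l a b s - graph_r l a b s.

Lemma graph_level_itv l a b s : {homo l : x y / x <= y} -> a <= b ->
  a + l a <= graph_level l a b s <= b + l b.
Proof.
move=> ml ab; have /andP[c0 c1] := clamp01_itv s; have := ml _ _ ab => lab.
have D0 : 0 <= (b + l b) - (a + l a) by lra.
by rewrite /graph_level; apply/andP; split; nra.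
Qed.

Lemma graph_level_lip l a b s t : {homo l : x y / x <= y} -> a <= b -> s <= t ->
  0 <= graph_level l a b t - graph_level l a b s
    <= ((b + l b) - (a + l a)) * (t - s).
Proof.
move=> ml ab st; have /andP[c0 c1] := clamp01_lip st; have := ml _ _ ab => lab.
have D0 : 0 <= (b + l b) - (a + l a) by lra.
rewrite /graph_level; apply/andP; split; nra.
Qed.

Lemma graph_parametrization l a b : rcnd l -> a <= b ->
  M1_parametrization a b l (graph_r l a b) (graph_u l a b).
Proof.
move=> rl ab; have ml := rl.1.
have rlip s t : s <= t -> 0 <= graph_r l a b t - graph_r l a b s
    <= graph_level l a b t - graph_level l a b s.
  move=> st; have /andP[? ?] := graph_level_itv s ml ab.
  have /andP[? ?] := graph_level_itv t ml ab.
  have /andP[? ?] := graph_level_lip ml ab st.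
  by apply: (graph_time_lip rl ab) => //; lra.
split.
- apply/continuous_subspaceT/(nondecreasing_lip_continuous
    (k := (b + l b) - (a + l a))) => s t st.
  have /andP[? ?] := rlip _ _ st; have /andP[? ?] := graph_level_lip ml ab st.
  by rewrite ger0_norm//; lra.
- apply/continuous_subspaceT/(nondecreasing_lip_continuous
    (k := (b + l b) - (a + l a))) => s t st.
  have /andP[? ?] := rlip _ _ st; have /andP[? ?] := graph_level_lip ml ab st.
  by rewrite /graph_u ger0_norm//; lra.
- apply/seteqP; split => [_ [s _ <-]|[t y]]; rewrite /completed_graph/=.
    have /andP[s1 s2] := graph_level_itv s ml ab.
    have [ar rb sr _] := graph_time_spec rl ab s2.
    have L := graph_time_left rl ab s1 s2.
    split; first by rewrite ar rb.
    rewrite -/(graph_r l a b s) in L sr.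
    rewrite /graph_u; move: (graph_r l a b s) L sr => r L sr.
    have lr : 0 <= l r - M1_leftlim a l r by lra.
    have [E|/eqP N] := eqVneq (l r) (M1_leftlim a l r).
      exists 0; first lra.
      by lra.
    have D0 : 0 < l r - M1_leftlim a l r.
      by rewrite lt_def lr andbT subr_eq0; apply/eqP.
    (* The weight that places the height [graph_level l a b s - r] on the vertical segment over r;
       the case of a segment reduced to a point was handled just before. *)
    exists ((l r - (graph_level l a b s - r)) / (l r - M1_leftlim a l r)).
      rewrite divr_ge0//=; last lra.
      rewrite ler_pdivrMr// mul1r.
      by lra.
    have : (l r - (graph_level l a b s - r)) / (l r - M1_leftlim a l r) *
      (l r - M1_leftlim a l r) = l r - (graph_level l a b s - r).
      by rewrite divfK// gt_eqF.
    nra.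
  move=> [tab [c c01 yE]].
  have L : M1_leftlim a l t <= l t.
    by rewrite /M1_leftlim; case: eqP => [->//|_]; exact: leftlim_le_at.
  have yt : M1_leftlim a l t <= y <= l t by rewrite yE; apply/andP; split; nra.
  have [s1 s2 rt] := graph_time_inv rl tab yt.
  have D0 : 0 <= (b + l b) - (a + l a) by lra.
  have [s s01 sE] : exists2 s, 0 <= s <= 1 &
      (a + l a) + s * ((b + l b) - (a + l a)) = t + y.
    have [E|/eqP N] := eqVneq ((b + l b) - (a + l a)) 0.
      by exists 0; [lra|rewrite E; lra].
    have {}D0 : 0 < (b + l b) - (a + l a) by rewrite lt_def D0 andbT; apply/eqP.
    exists ((t + y - (a + l a)) / ((b + l b) - (a + l a))).
      by rewrite divr_ge0 ?(ltW D0) ?ler_pdivrMr ?mul1r//=; lra.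
    by rewrite divfK ?gt_eqF//; lra.
  exists s; first by rewrite /= in_itv.
  have E : graph_level l a b s = t + y by rewrite /graph_level clamp01_id.
  by rewrite /graph_u /graph_r E rt; congr pair; lra.
- move=> s t s0 st t1; rewrite /graph_le /=.
  have /andP[? ?] := rlip _ _ st; have /andP[? ?] := graph_level_lip ml ab st.
  have /andP[s1 s2] := graph_level_itv s ml ab.
  have /andP[t1' t2] := graph_level_itv t ml ab.
  have Ls := graph_time_left rl ab s1 s2.
  have Lt := graph_time_left rl ab t1' t2.
  have [rr|rr] : graph_r l a b s < graph_r l a b t \/
      graph_r l a b s = graph_r l a b t.
    by case: (ltgtP (graph_r l a b s) (graph_r l a b t)); [left|lra|right].
  + by left.
  + right; split => //; rewrite !ler0_norm /graph_u ?rr; last 2 first.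
    * by move: Lt; rewrite -/(graph_r l a b t); lra.
    * by move: Ls; rewrite -/(graph_r l a b s) rr; lra.
    * lra.
Qed.

(** At a common parameter the levels differ by at most e, because they do at both ends and are
    affine in between. The times then differ by at most 2 e, and the heights, as differences of
    level and time, by at most 3 e. *)
Lemma M1_dist_le f g a b e : rcnd f -> rcnd g -> a <= b -> 0 <= e ->
  (forall t, a <= t <= b -> f t <= g (t + e) + e) ->
  (forall t, a <= t <= b -> g t <= f (t + e) + e) ->
  `|f a - g a| <= e -> `|f b - g b| <= e ->
  (M1_dist a b f g <= (3 * e)%:E)%E.
Proof.
move=> rf rg ab e0 fg gf ea eb.
apply: (@le_trans _ _ (maxe
  (sup_dist01 (graph_r f a b) (graph_r g a b))
  (sup_dist01 (graph_u f a b) (graph_u g a b)))).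
  apply: ereal_inf_lbound.
  exists (graph_r f a b), (graph_u f a b), (graph_r g a b), (graph_u g a b).
  by split => //; exact: graph_parametrization.
have lev s : `|graph_level f a b s - graph_level g a b s| <= e.
  have /andP[c0 c1] := clamp01_itv s; rewrite /graph_level.
  move: ea eb; rewrite !ler_norml => /andP[? ?] /andP[? ?].
  by apply/andP; split; nra.
have rr s : `|graph_r f a b s - graph_r g a b s| <= 2 * e.
  have /andP[? ?] := graph_level_itv s rf.1 ab.
  have /andP[? ?] := graph_level_itv s rg.1 ab.
  have h1 := @graph_time_close f g a b (graph_level f a b s)
    (graph_level g a b s) e rf rg ab e0 fg ltac:(by []) ltac:(by []) ltac:(by []).
  have h2 := @graph_time_close g f a b (graph_level g a b s)
    (graph_level f a b s) e rg rf ab e0 gf ltac:(by []) ltac:(by []) ltac:(by []).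
  rewrite distrC in h2; have := lev s => L.
  by rewrite ler_norml /graph_r; apply/andP; split; lra.
rewrite ge_max; apply/andP; split; apply: ge_ereal_sup => _ [s _ <-];
  rewrite lee_fin.
  by have := rr s; lra.
have := rr s; have := lev s; rewrite /graph_u !ler_norml.
by move=> /andP[? ?] /andP[? ?]; apply/andP; split; lra.
Qed.

Lemma ereal_cvg0P (h : nat -> \bar R) : (forall n, (0 <= h n)%E) ->
  h @ \oo --> 0%E <->
  (forall e, 0 < e -> exists N, forall n, (N <= n)%N -> (h n <= e%:E)%E).
Proof.
move=> h0; split.
  move=> H e e0.
  have [N _ HN] : \forall n \near \oo, (h n < e%:E)%E.
    by apply: (H _ (open_ereal_lt' _)); rewrite lte_fin.
  by exists N => n Nn; exact/ltW/HN.
move=> H; apply/fine_cvgP; split.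
  have [N HN] := H 1 ltr01; exists N => // n /= /HN h1.
  by rewrite ge0_fin_numE//; apply: le_lt_trans h1 _; rewrite ltry.
apply/cvgrPdist_le => e e0; have [N HN] := H e e0.
exists N => // n /= /HN h1; rewrite sub0r normrN.
have hf : h n \is a fin_num.
  by rewrite ge0_fin_numE//; apply: le_lt_trans h1 _; rewrite ltry.
by rewrite ger0_norm ?fine_ge0// -lee_fin fineK.
Qed.

Lemma M1_dist_ge0 a b f g : (0 <= M1_dist a b f g)%E.
Proof.
apply: le_ereal_inf_tmp => _ [r1 [u1 [r2 [u2 [_ _ ->]]]]].
rewrite le_max; apply/orP; left; apply: ereal_sup_ge.
exists (`|r1 0 - r2 0|)%:E; last by rewrite lee_fin.
by exists 0 => //; rewrite /= in_itv/= lexx ler01.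
Qed.

(* For monotone functions this is convergence at the continuity points of the
   limit. *)
Definition wcvg (f : nat -> R -> R) g := forall t e, 0 < e ->
  exists N, forall n, (N <= n)%N -> g (t - e) - e <= f n t <= g (t + e) + e.

Lemma exists_bound_on (P : nat -> nat -> Prop) m :
  (forall i, exists N, forall n, (N <= n)%N -> P i n) ->
  exists N, forall n, (N <= n)%N -> forall i, (i <= m)%N -> P i n.
Proof.
move=> H; elim: m => [|m [N HN]].
  by have [N HN] := H 0%N; exists N => n /HN Hn [|].
have [N' HN'] := H m.+1; exists (maxn N N') => n; rewrite geq_max.
move=> /andP[Nn Nn'] i; rewrite leq_eqVlt => /predU1P[->|]; first exact: HN'.
by rewrite ltnS; exact: HN.
Qed.

Lemma wcvg_uniform (f : nat -> R -> R) g a b e :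
  (forall n, {homo f n : s t / s <= t}) -> {homo g : s t / s <= t} ->
  wcvg f g -> 0 < e -> exists N, forall n, (N <= n)%N ->
  forall t, a <= t <= b -> f n t <= g (t + e) + e /\ g t <= f n (t + e) + e.
Proof.
move=> mf mg fg e0; have e2 : 0 < e / 2 by lra.
(* Convergence is used on a finite grid of mesh e / 2. For t in cell i < m, monotonicity transfers
   the bounds from the points i + 1 and i + 2 to t, at the cost of a time shift e. *)
pose m := Num.bound ((b - a) / (e / 2)).
have [N' HN'] := exists_bound_on m.+1 (fun i => fg (a + (i%:R * (e / 2))) _ e2).
exists N' => n Nn t /andP[at_ tb].
pose i := Num.trunc ((t - a) / (e / 2)).
have q0 : 0 <= (t - a) / (e / 2) by rewrite divr_ge0 ?(ltW e2)//; lra.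
have /andP[i1 i2] := truncn_itv q0.
have {}i1 : i%:R * (e / 2) <= t - a by rewrite -ler_pdivlMr.
have {}i2 : t - a < i.+1%:R * (e / 2) by rewrite -ltr_pdivrMr.
have im : (i < m)%N.
  rewrite -(ltr_nat R); apply: (@le_lt_trans _ _ ((b - a) / (e / 2))).
    by rewrite ler_pdivlMr//; lra.
  have := @archi_boundP R ((b - a) / (e / 2)); apply.
  by rewrite divr_ge0 ?(ltW e2)//; lra.
have /andP[_ h1] := HN' n Nn i.+1 ltac:(by rewrite ltnS ltnW).
have /andP[h2 _] := HN' n Nn i.+1 ltac:(by rewrite ltnS ltnW).
have E : i.+1%:R * (e / 2) = i%:R * (e / 2) + e / 2 by rewrite -addn1 natrD mulrDl mul1r.
rewrite E in i2 h1 h2; split.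
- have := @homo_leW _ _ t (a + (i%:R * (e / 2) + e / 2)) (mf n) ltac:(lra).
  have := @homo_leW _ _ (a + (i%:R * (e / 2) + e / 2) + e / 2) (t + e) mg ltac:(lra); lra.
- have [/andP[h3 _]] : g (a + i.+1.+1%:R * (e / 2) - e / 2) - e / 2 <=
      f n (a + i.+1.+1%:R * (e / 2)) <= g (a + i.+1.+1%:R * (e / 2) + e / 2) + e / 2.
    by apply: HN' => //; rewrite ltnS.
  have E' : i.+2%:R * (e / 2) = i%:R * (e / 2) + e / 2 + e / 2.
    by rewrite -addn1 natrD mulrDl mul1r E.
  rewrite E' in h3.
  have := @homo_leW _ _ (a + (i%:R * (e / 2) + e / 2 + e / 2)) (t + e) (mf n) ltac:(lra).
  have := @homo_leW _ _ t (a + (i%:R * (e / 2) + e / 2 + e / 2) - e / 2) mg ltac:(lra); lra.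
Qed.

Lemma wcvg_pointwise (f : nat -> R -> R) g t e :
  (forall n, {homo f n : s u / s <= u}) -> rcnd g ->
  wcvg f g -> left_continuous_at g t -> 0 < e ->
  exists N, forall n, (N <= n)%N -> `|f n t - g t| <= e.
Proof.
move=> mf [mg rg] fg lg e0; have e2 : 0 < e / 2 by lra.
have [d d0 gd] := rg t _ e2; have [s st gs] := lg _ e2.
pose c := Num.min (e / 2) (Num.min d (t - s)).
have c0 : 0 < c by rewrite !lt_min e2 d0 subr_gt0.
have c1 : c <= e / 2 by rewrite ge_min lexx.
have c2 : c <= d by rewrite !ge_min lexx orbT.
have c3 : c <= t - s by rewrite !ge_min lexx !orbT.
have [N HN] := fg t c c0; exists N => n /HN /andP[h1 h2].
have := @homo_leW _ _ s (t - c) mg ltac:(lra); have := @homo_leW _ _ (t + c) (t + d) mg ltac:(lra).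
by move=> ? ?; rewrite ler_norml; apply/andP; split; lra.
Qed.

Lemma wcvg_M1_cvg (f : nat -> R -> R) g :
  (forall n, Mspace (f n)) -> Mspace g -> wcvg f g -> M1_cvg f g.
Proof.
move=> Mf Mg fg; have rg := Mspace_rcnd Mg.
(* The estimate on the M1 distance needs closeness of the values at the right end, so the horizons
   are taken at continuity points of the limit. At the left end -1 all functions vanish. *)
have /choice[T HT] : forall N : nat, exists t : R,
    N%:R < t < N.+1%:R /\ left_continuous_at g t.
  move=> N; have NN : N%:R < N.+1%:R :> R by rewrite ltr_nat.
  by have [t ? ?] := exists_left_continuous_at rg NN; exists t.
have T0 N : 0 < T N.
  by have [/andP[h _] _] := HT N; apply: le_lt_trans h; rewrite ler0n.
exists T; split.
- by move=> N; have := T0 N; lra.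
- apply/nondecreasing_seqP => N.
  have [/andP[_ h] _] := HT N; have [/andP[h' _] _] := HT N.+1.
  by apply: ltW; exact: lt_trans h'.
- apply/cvgryPge => A; near=> N.
  have [/andP[h _] _] := HT N; apply: le_trans (ltW h).
  by near: N; exact: nbhs_infty_ger.
- move=> N; apply/ereal_cvg0P => [n|e e0]; first exact: M1_dist_ge0.
  have e3 : 0 < e / 3 by lra.
  have mf n := Mspace_homo (Mf n); have mg := Mspace_homo Mg.
  have [N1 H1] := @wcvg_uniform f g (-1) (T N) (e / 3) mf mg fg e3.
  have [N2 H2] := wcvg_pointwise mf rg fg (HT N).2 e3.
  exists (maxn N1 N2) => n; rewrite geq_max => /andP[n1 n2].
  have -> : e = 3 * (e / 3) by lra.
  have N1' : -1 < 0 :> R by lra.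
  apply: M1_dist_le; rewrite ?(ltW e3)//.
  + exact: Mspace_rcnd.
  + by have := T0 N; lra.
  + by move=> t tT; have [] := H1 n n1 t tT.
  + by move=> t tT; have [] := H1 n n1 t tT.
  + by rewrite (Mspace_lt0 (Mf n))// (Mspace_lt0 Mg)// subrr normr0 ltW.
  + exact: H2.
Unshelve. all: by end_near. Qed.

(** A small M1 distance puts a point of the completed graph of [f n] near (t, g t). By monotonicity
    of [f n], its height lies between the values of [f n] shortly before and after t, hence between
    those of K up to a shift. Right continuity removes the shift; g itself is not assumed
    monotone. *)
Lemma M1_cvg_unique (f : nat -> R -> R) K g :
  (forall n, Mspace (f n)) -> Mspace K -> wcvg f K -> Dspace g ->
  M1_cvg f g -> g = K.
Proof.
move=> Mf MK fK [rg cg g0] [T [T1 Tm Too HT]].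
have mK := Mspace_homo MK; have rK := Mspace_rcnd MK.
have key t e : -1 < t -> 0 < e -> K (t - e) - e <= g t <= K (t + e) + e.
  move=> t1 e0; have e4 : 0 < e / 4 by lra.
  have [N TN] : exists N, t + 1 <= T N.
    have /cvgryPge/(_ (t + 1))[N _ HN] := Too; exists N.
    by apply: HN; rewrite /=.
  have [N1 H1] := (ereal_cvg0P (fun n => M1_dist_ge0 _ _ (f n) g)).1 (HT N)
    (e / 8) ltac:(lra).
  have [N2 H2] := fK (t + e / 4) _ e4.
  have [N3 H3] := fK (t - e / 2) _ e4.
  pose n := maxn N1 (maxn N2 N3).
  have /H1 D : (N1 <= n)%N by rewrite leq_maxl.
  have /H2/andP[_ h2] : (N2 <= n)%N by rewrite /n !leq_max leqnn orbT.
  have /H3/andP[h3 _] : (N3 <= n)%N by rewrite /n !leq_max leqnn !orbT.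
  have : (M1_dist (-1) (T N) (f n) g < (e / 4)%:E)%E.
    by apply: le_lt_trans D _; rewrite lte_fin; lra.
  move=> /ereal_inf_lt[_ [r1 [u1 [r2 [u2 [[_ _ G1 _] [_ _ G2 _] ->]]]]]].
  rewrite gt_max => /andP[dr du].
  have : completed_graph (-1) (T N) g (t, g t).
    split => /=; first by apply/andP; split; lra.
    by exists 0; [lra|rewrite mul0r add0r subr0 mul1r].
  rewrite -G2 => -[s s01 [r2t u2t]].
  have : completed_graph (-1) (T N) (f n) (r1 s, u1 s) by rewrite -G1; exists s.
  move=> [/= /andP[rs1 rs2] [c c01 uE]].
  have {}dr : `|r1 s - t| < e / 4.
    rewrite -lte_fin; apply: le_lt_trans dr; apply: ereal_sup_ubound.
    by exists s => //; rewrite r2t.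
  have {}du : `|u1 s - g t| < e / 4.
    rewrite -lte_fin; apply: le_lt_trans du; apply: ereal_sup_ubound.
    by exists s => //; rewrite u2t.
  move: dr du; rewrite !ltr_norml => /andP[d1 d2] /andP[d3 d4].
  have mf := Mspace_homo (Mf n).
  have f1 : f n (r1 s) <= f n (t + e / 4) by apply: mf; lra.
  have f2 : f n (t - e / 2) <= M1_leftlim (-1) (f n) (r1 s).
    rewrite /M1_leftlim; case: eqP => [<-|_]; first by apply: mf; lra.
    by apply: leftlim_ge => //; lra.
  have f3 : M1_leftlim (-1) (f n) (r1 s) <= f n (r1 s).
    by rewrite /M1_leftlim; case: eqP => [->//|_]; exact: leftlim_le_at.
  have u1a : u1 s <= f n (r1 s) by rewrite uE; nra.
  have u1b : M1_leftlim (-1) (f n) (r1 s) <= u1 s by rewrite uE; nra.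
  have := @homo_leW _ _ (t - e) (t - e / 2 - e / 4) mK ltac:(lra).
  have := @homo_leW _ _ (t + e / 4 + e / 4) (t + e) mK ltac:(lra).
  by move=> ? ?; apply/andP; split; lra.
have gK t : -1 < t -> g t = K t.
  move=> t1; apply/eqP; rewrite eq_le; apply/andP; split.
    apply/ler_addgt0Pr => e e0.
    have [d d0 Kd] := rK.2 t (e / 2) ltac:(lra).
    pose c := Num.min d (e / 2).
    have c0 : 0 < c by rewrite lt_min d0/=; lra.
    have c1 : c <= d by rewrite ge_min lexx.
    have c2 : c <= e / 2 by rewrite ge_min lexx orbT.
    have /andP[_ h] := key t c t1 c0.
    have := @homo_leW _ _ (t + c) (t + d) mK ltac:(lra); lra.
  apply/ler_addgt0Pl => e e0.
  have /cvgrPdist_lt/(_ (e / 2) ltac:(lra))[d /= d0 Hd] := rg t.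
  pose c := Num.min (d / 2) (e / 2).
  have c0 : 0 < c by rewrite lt_min; apply/andP; split; lra.
  have c1 : c <= d / 2 by rewrite ge_min lexx.
  have c2 : c <= e / 2 by rewrite ge_min lexx orbT.
  have := Hd (t + c); rewrite /= opprD addrA subrr sub0r normrN gtr0_norm//.
  move=> /(_ ltac:(lra) ltac:(lra)); rewrite ltr_norml => /andP[h1 h2].
  have /andP[h3 _] := key (t + c) c ltac:(lra) c0.
  by move: h3; rewrite addrK; lra.
(* Times up to -1 are out of reach of [key]; there the two functions agree because elements of
   [Dspace] are constant on the negative half-line. *)
apply/funext => t; have [|t1] := ltP (-1) t; first exact: gK.
have t0 : t < 0 by lra.
have N2 : -1 / 2 < 0 :> R by lra.
rewrite (Mspace_lt0 MK t0) g0// -(g0 _ N2) gK; last lra.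
exact: Mspace_lt0.
Qed.

End M1.

(** * Hitting times of moving boundaries *)

Section hits.
Context {R : realType}.
Implicit Types (l z : R -> R) (a b s t e : R).

Lemma continuous_eps z t e : continuous z -> 0 < e ->
  exists2 d, 0 < d & forall u, `|u - t| < d -> `|z u - z t| < e.
Proof.
move=> cz e0; have /cvgrPdist_lt/(_ e e0)[d /= d0 H] := cz t.
by exists d => // u ud; rewrite distrC; apply: H; rewrite /= distrC.
Qed.

Lemma first_hit z l a b : continuous z -> rcnd l ->
  (exists2 s, a <= s <= b & z s <= l s) ->
  exists2 s, a <= s <= b /\ z s <= l s &
    forall t, a <= t <= b -> z t <= l t -> s <= t.
Proof.
move=> cz [ml rl] [s0 s0ab zs0].
pose S := [set s | a <= s <= b /\ z s <= l s].
have lS : has_lbound S by exists a => t [/andP[]].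
exists (inf S); last by move=> t tab zt; exact: ge_inf.
suff : S (inf S) by [].
apply: inf_attained => //; first by exists s0.
move=> t H; have at_ : a <= t.
  rewrite leNgt; apply/negP => ta.
  have [u /andP[tu ud] [/andP[au _] _]] := H (a - t) ltac:(lra); lra.
have tb : t <= b.
  have [u /andP[tu ud] [/andP[_ ub] _]] := H 1 ltr01; lra.
split; first by rewrite at_ tb.
rewrite leNgt; apply/negP => zt.
have e0 : 0 < (z t - l t) / 2 by lra.
have [d d0 ld] := rl t _ e0; have [d' d'0 zd] := continuous_eps t cz e0.
have m0 : 0 < Num.min d d' by rewrite lt_min d0.
have m1 : Num.min d d' <= d by rewrite ge_min lexx.
have m2 : Num.min d d' <= d' by rewrite ge_min lexx orbT.
have [u /andP[tu ud] [_ zu]] := H _ m0.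
have := zd u; rewrite ger0_norm; last lra.
move=> /(_ ltac:(lra)); rewrite ltr_norml => /andP[h1 _].
have := @homo_leW _ l u (t + d) ml ltac:(lra); lra.
Qed.

(* The first hitting times [s n] increase to a limit [s], and
   [l n (s n) <= l m s] for [m <= n]. *)
Lemma limit_hit z (l : nat -> R -> R) (K : R -> R) (eps : nat -> R) a b :
  continuous z -> (forall n, rcnd (l n)) ->
  (forall m n s, (m <= n)%N -> l n s <= l m s) ->
  (forall s e, 0 < e -> exists n, l n s < K s + e) ->
  (forall m n, (m <= n)%N -> eps n <= eps m) ->
  (forall e, 0 < e -> exists n, eps n <= e) ->
  (forall n, exists2 s, a <= s <= b & z s - eps n <= l n s) ->
  exists2 s, a <= s <= b & z s <= K s.
Proof.
move=> cz rl lnm lK epsm eps0 H.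
have czn n : continuous (fun s => z s - eps n).
  by move=> t; apply: cvgB; [exact: cz|exact: cvg_cst].
have /choice[s Hs] : forall n, exists s, (a <= s <= b /\ z s - eps n <= l n s) /\
    forall t, a <= t <= b -> z t - eps n <= l n t -> s <= t.
  by move=> n; have [s ? ?] := first_hit (czn n) (rl n) (H n); exists s.
have sm m n : (m <= n)%N -> s m <= s n.
  move=> mn; have [[sab zs] _] := Hs n; have [_ h] := Hs m; apply: h => //.
  by have := lnm m n (s n) mn; have := epsm m n mn; lra.
pose S := range s; have hS : has_sup S.
  split; first by exists (s 0%N), 0%N.
  by exists b => _ [n _ <-]; have [[/andP[]]] := Hs n.
have sS n : s n <= sup S by apply: sup_ubound => //; [exact: hS.2|exists n].
exists (sup S).
  have [[/andP[h _] _] _] := Hs 0%N; rewrite (le_trans h (sS 0%N))/=.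
  by apply: sup_le_ub; [exact: hS.1|move=> _ [n _ <-]; have [[/andP[]]] := Hs n].
rewrite leNgt; apply/negP => zK.
have e0 : 0 < (z (sup S) - K (sup S)) / 4 by lra.
have [n1 h1] := lK (sup S) _ e0; have [n2 h2] := eps0 _ e0.
have [d d0 zd] := continuous_eps (sup S) cz e0.
have [_ [n3 _ <-] h3] := sup_adherent d0 hS.
pose n := maxn n1 (maxn n2 n3).
have l1 : (n1 <= n)%N by rewrite leq_maxl.
have l2 : (n2 <= n)%N by rewrite /n !leq_max leqnn orbT.
have l3 : (n3 <= n)%N by rewrite /n !leq_max leqnn !orbT.
have [[_ zs] _] := Hs n; have := sm _ _ l3; have := sS n => g1 g2.
have := zd (s n); rewrite ler0_norm; last lra.
move=> /(_ ltac:(lra)); rewrite ltr_norml => /andP[g3 _].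
have g4 := lnm _ _ (s n) l1; have g5 := epsm _ _ l2.
have := homo_leW (rl n1).1 g1; lra.
Qed.

Definition hits (T : Type) (Z : R -> T -> R) l a b : set T :=
  [set w | exists2 s, a <= s <= b & Z s w <= l s].

Definition hits_lt (T : Type) (Z : R -> T -> R) l a b : set T :=
  [set w | exists2 s, a <= s <= b & Z s w < l s].

Definition hits_before (T : Type) (Z : R -> T -> R) l t : set T :=
  [set w | exists2 s, 0 <= s < t & Z s w <= l s].

Lemma rcnd_addr l (c : R) : rcnd l -> rcnd (fun s => l s + c).
Proof.
move=> [ml rl]; split=> [s t st|t e e0].
  by rewrite lerD2r; exact: ml.
by have [d d0 H] := rl t e e0; exists d => //; lra.
Qed.

Lemma invSn_gt0 n : 0 < n.+1%:R^-1 :> R.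
Proof. by rewrite invr_gt0 ltr0n. Qed.

Lemma invSn_le m n : (m <= n)%N -> n.+1%:R^-1 <= m.+1%:R^-1 :> R.
Proof. by move=> mn; rewrite lef_pV2 ?posrE ?ltr0n// ler_nat ltnS. Qed.

Lemma invSn_small e : 0 < e -> exists n, n.+1%:R^-1 < e.
Proof.
move=> e0; exists (Num.bound e^-1).
rewrite invf_plt ?posrE ?ltr0n//.
apply: (@lt_trans _ _ (Num.bound e^-1)%:R); last by rewrite ltr_nat.
by apply: archi_boundP; rewrite invr_ge0 ltW.
Qed.

Lemma measurable_preimage d (T : measurableType d) d' (T' : measurableType d')
    (f : T -> T') (A : set T') :
  measurable_fun setT f -> measurable A -> measurable (f @^-1` A).
Proof. by move=> mf mA; rewrite -[X in measurable X]setTI; exact: mf. Qed.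

Section measurable_hits.
Context d (T : measurableType d) (Z : R -> T -> R).
Hypothesis cZ : forall w, continuous (Z ^~ w).

(** A strict hit at s persists for a short time after s, since paths are continuous and l does not
    decrease. Rational times therefore suffice. *)
Lemma measurable_hits_lt l a b :
  (forall s, a <= s <= b -> measurable_fun setT (Z s)) ->
  {homo l : s t / s <= t} -> measurable (hits_lt Z l a b).
Proof.
move=> mZ ml; have [ab|ba] := leP a b; last first.
  rewrite (_ : hits_lt _ _ _ _ = set0)// -subset0 => w [s /andP[? ?] _].
  suff : b < b by rewrite ltxx.
  lra.
(* Projecting the rationals onto [a, b] also samples the end b, where a strict hit has no later time
   in the interval to persist to. *)
pose c (q : rat) : R := Num.max a (Num.min b (ratr q)).
have cab q : a <= c q <= b by rewrite /c le_max lexx/= ge_max ab ge_min lexx.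
rewrite (_ : hits_lt _ _ _ _ = \bigcup_q [set w | Z (c q) w < l (c q)]); last first.
  apply/seteqP; split=> [w [s /andP[as_ sb] zs]|w [q _ zq]]; last by exists (c q).
  move: zs; have [->|/eqP sb'] := eqVneq s b => zs.
    have [q] := rat_in_itvoo (ltac:(by rewrite ltrDl) : b < b + 1).
    rewrite in_itv/= => /andP[bq _].
    exists q => //=; rewrite /c (min_idPl _)//; last exact: ltW.
    by rewrite (max_idPr _).
  have {}sb : s < b by rewrite lt_def sb andbT eq_sym; apply/eqP.
  have [e e0 ze] := @continuous_eps (Z ^~ w) s (l s - Z s w) (@cZ w) ltac:(lra).
  have [q] := rat_in_itvoo
    (ltac:(by rewrite lt_min sb ltrDl) : s < Num.min b (s + e)).
  rewrite in_itv/= => /andP[q1 q2].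
  have [qb qe] : ratr q < b /\ ratr q < s + e.
    by move: q2; rewrite lt_min => /andP[].
  exists q => //=; have -> : c q = ratr q.
    by rewrite /c (min_idPr (ltW qb)) (max_idPr _)//; lra.
  have := ze (ratr q); rewrite ger0_norm; last lra.
  move=> /(_ ltac:(lra)); rewrite ltr_norml => /andP[_ h].
  have := homo_leW ml (ltW q1); lra.
apply: bigcupT_measurable_rat => q.
rewrite (_ : [set w | _] = Z (c q) @^-1` `]-oo, l (c q)[%classic).
  by apply: measurable_preimage => //; exact: mZ.
by apply/seteqP; split=> w; rewrite /= in_itv.
Qed.

(** By compactness, a path hits l as soon as it strictly hits every boundary raised by 1 / (n +
    1). *)
Lemma measurable_hits l a b :
  (forall s, a <= s <= b -> measurable_fun setT (Z s)) ->
  rcnd l -> measurable (hits Z l a b).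
Proof.
move=> mZ rl.
rewrite (_ : hits _ _ _ _ =
    \bigcap_n hits_lt Z (fun s => l s + n.+1%:R^-1) a b); last first.
  apply/seteqP; split=> [w [s sab zs] n _|w H].
    by exists s => //=; move: (_^-1) (invSn_gt0 n) => c c0; lra.
  apply: (@limit_hit _ (fun _ => l) l (fun n => n.+1%:R^-1)) => //.
  - by move=> s e e0; exists 0%N; rewrite ltrDl.
  - exact: invSn_le.
  - by move=> e /invSn_small[n /ltW ?]; exists n.
  - move=> n; have [//|s sab /= zs] := H n; exists s => //.
    by move: (_^-1) zs => c zs; lra.
apply: bigcapT_measurable => n; apply: measurable_hits_lt => //.
by have [] := rcnd_addr n.+1%:R^-1 rl.
Qed.

Lemma measurable_hits_before l t :
  (forall s, 0 <= s -> measurable_fun setT (Z s)) ->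
  rcnd l -> measurable (hits_before Z l t).
Proof.
move=> mZ rl.
rewrite (_ : hits_before _ _ _ = \bigcup_n hits Z l 0 (t - n.+1%:R^-1)).
  apply: bigcupT_measurable => n; apply: measurable_hits => // s /andP[s0 _].
  exact: mZ.
apply/seteqP; split=> [w [s /andP[s0 st] zs]|w [n _ [s /andP[s0 st] zs]]].
  have [n Hn] := invSn_small (ltac:(lra) : 0 < t - s).
  by exists n => //; exists s => //; rewrite s0/=; move: (_^-1) Hn => c Hn; lra.
by exists s => //; rewrite s0/=; move: (_^-1) (invSn_gt0 n) st => c c0 st; lra.
Qed.

End measurable_hits.

(** The state with the boundary added back: one fixed continuous path can then be compared with
    several boundaries. *)
Definition particle (T : Type) (X0 : T -> R) (B : R -> T -> R) (t : R) (w : T) : R :=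
  X0 w + B (Num.max t 0) w.

Lemma stateE (T : Type) (X0 : T -> R) (B : R -> T -> R) l t w :
  state X0 B l t w = particle X0 B t w - l t.
Proof. by []. Qed.

Lemma hitting_time_leP (T : Type) (X0 : T -> R) (B : R -> T -> R) l t w :
  continuous (particle X0 B ^~ w) -> rcnd l ->
  (hitting_time X0 B l w <= t%:E)%E <-> hits (particle X0 B) l 0 t w.
Proof.
move=> cz rl; split; last first.
  move=> [s /andP[s0 st] zs]; apply: ge_ereal_inf; exists s%:E => //.
  by exists s => //=; rewrite s0 stateE subr_le0.
move=> Ht.
have [s0 /andP[s00 _] zs0] : exists2 s, 0 <= s <= s & particle X0 B s w <= l s.
  apply: contrapT => /forall2NP H; move: Ht; rewrite /hitting_time.
  rewrite (_ : [set t%:E | t in _] = set0) ?ereal_inf0//.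
  rewrite -subset0 => y [s [s0 +] _]; rewrite stateE subr_le0 => zs.
  by have [|] := H s; rewrite ?s0 ?lexx.
have [|s [/andP[s1 s2] zs] smin] := @first_hit _ l 0 s0 cz rl.
  by exists s0 => //; rewrite s00 lexx.
exists s => //; rewrite s1/= -lee_fin; apply: le_trans Ht.
apply: le_ereal_inf_tmp => _ [u [u0 +] <-]; rewrite stateE subr_le0 lee_fin => zu.
have [us|] := leP u s0; last lra.
by apply: smin => //; rewrite u0.
Qed.

Lemma hitting_time_geP (T : Type) (X0 : T -> R) (B : R -> T -> R) l t w :
  (t%:E <= hitting_time X0 B l w)%E <-> ~ hits_before (particle X0 B) l t w.
Proof.
split=> [Ht [s /andP[s0 st] zs]|H].
  have : (hitting_time X0 B l w <= s%:E)%E.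
    apply: ge_ereal_inf; exists s%:E => //.
    by exists s => //=; rewrite s0 stateE subr_le0.
  by move=> /(le_trans Ht); rewrite lee_fin; lra.
apply: le_ereal_inf_tmp => _ [s [s0 +] <-]; rewrite stateE subr_le0 lee_fin => zs.
rewrite leNgt; apply/negP => st; apply: H.
by exists s => //; rewrite s0.
Qed.

End hits.

(** * Real-valued probabilities and their monotone continuity *)

Section probability_reals.
Context {R : realType} d (T : measurableType d) (P : probability T R).
Implicit Types (A C : set T) (F : nat -> set T).

Definition pr A : R := fine (P A).

Lemma prE A : measurable A -> P A = (pr A)%:E.
Proof. by move=> mA; rewrite fineK// fin_num_measure. Qed.

Lemma pr_set0 : pr set0 = 0.
Proof. by rewrite /pr measure0. Qed.

Lemma pr_ge0 A : 0 <= pr A.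
Proof. by rewrite fine_ge0. Qed.

Lemma pr_le1 A : measurable A -> pr A <= 1.
Proof. by move=> mA; rewrite -lee_fin -prE// probability_le1. Qed.

Lemma pr_le A C : measurable A -> measurable C -> A `<=` C -> pr A <= pr C.
Proof. by move=> mA mC AC; rewrite -lee_fin -!prE// le_measure ?inE. Qed.

Lemma pr_U A C : measurable A -> measurable C -> pr (A `|` C) <= pr A + pr C.
Proof.
move=> mA mC; rewrite -lee_fin EFinD -!prE//; last exact: measurableU.
exact: measureU2.
Qed.

Lemma pr_cover A C D : measurable A -> measurable C -> measurable D ->
  A `<=` C `|` D -> pr A <= pr C + pr D.
Proof.
by move=> mA mC mD AC; apply: le_trans (pr_U mC mD); apply: pr_le => //; exact: measurableU.
Qed.

Lemma pr_disjU A C : measurable A -> measurable C -> A `&` C = set0 ->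
  pr (A `|` C) = pr A + pr C.
Proof.
move=> mA mC AC; apply: EFin_inj; rewrite EFinD -!prE//; last exact: measurableU.
by rewrite measureU.
Qed.

Lemma pr_inc A F e : 0 < e -> measurable A -> (forall n, measurable (F n)) ->
  (forall m n, (m <= n)%N -> F m `<=` F n) -> A `<=` \bigcup_n F n ->
  exists n, pr A - e < pr (F n).
Proof.
move=> e0 mA mF ndF AF.
have mU : measurable (\bigcup_n F n) by exact: bigcupT_measurable.
have : P \o F @ \oo --> P (\bigcup_n F n) := nondecreasing_cvg_mu mF mU (fun m n mn => introT (@subsetPset _ _ _) (ndF m n mn)).
rewrite (prE mU) => /fine_cvgP[_ /cvgrPdist_lt/(_ e e0)[N _ H]].
exists N; have := H N (leqnn N).
rewrite /= ltr_norml => /andP[_ h].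
have := pr_le mA mU AF; rewrite /pr in h *; lra.
Qed.

Lemma pr_dec A F e : 0 < e -> measurable A -> (forall n, measurable (F n)) ->
  (forall m n, (m <= n)%N -> F n `<=` F m) -> \bigcap_n F n `<=` A ->
  exists n, pr (F n) < pr A + e.
Proof.
move=> e0 mA mF ndF FA.
have mU : measurable (\bigcap_n F n) by exact: bigcapT_measurable.
have F0 : (P (F 0%N) < +oo)%E by rewrite prE// ltry.
have : P \o F @ \oo --> P (\bigcap_n F n) := nonincreasing_cvg_mu F0 mF mU (fun m n mn => introT (@subsetPset _ _ _) (ndF m n mn)).
rewrite (prE mU) => /fine_cvgP[_ /cvgrPdist_lt/(_ e e0)[N _ H]].
exists N; have := H N (leqnn N).
rewrite /= ltr_norml => /andP[h _].
have := pr_le mU mA FA; rewrite /pr in h *; lra.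
Qed.

End probability_reals.

(** * Independence of Brownian increments *)

(** Uniqueness of measures on a pi-system: E |-> P (E [&] C) and E |-> P E * P C are finite measures
    that agree on G, and G contains the whole space. *)
Lemma independent_sigma_algebra (R : realType) d (T : measurableType d)
    (P : probability T R) (G : set_system T) (C E : set T) :
  G `<=` measurable -> setI_closed G -> G setT -> measurable C ->
  (forall A, G A -> P (A `&` C) = (P A * P C)%E) ->
  <<s G >> E -> P (E `&` C) = (P E * P C)%E.
Proof.
move=> Gm GI GT mC GC sE.
pose m1 : {measure set T -> \bar R} := mrestr P mC.
pose m2 : {measure set T -> \bar R} := mscale (NngNum (pr_ge0 P C)) P.
have m2E A : m2 A = (P A * P C)%E by rewrite muleC /m2 /= /mscale/= (prE _ mC).
rewrite -m2E -[LHS]/(m1 E).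
apply: (@g_sigma_algebra_measure_unique _ _ _ G _ (fun=> setT)) => //.
- by rewrite bigcup_const//; exists 0%N.
- by move=> A /GC; rewrite m2E.
- by move=> _; rewrite /m1/= /mrestr (prE _ (measurableI _ _ measurableT mC)) ltry.
Qed.

Section independence.
Context {R : realType} d (T : measurableType d) (P : probability T R).
Variables (X0 : T -> R) (B : R -> {RV P >-> R}).
Hypotheses (bB : brownian_motion B) (mX0 : measurable_fun setT X0).
Hypothesis iX0 : independent_of_process P X0 B.

Lemma measurable_increment s t : measurable_fun setT (increment B s t).
Proof. by apply: measurable_funB. Qed.

Section grid.
Variables (t : nat -> R) (n k : nat).
Hypotheses (t0 : t 0%N = 0) (ndt : nondecreasing_seq t) (kn : (k < n)%N).

Let inc i := increment B (t i) (t i.+1).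

Let t_ge0 i : 0 <= t i. Proof. by rewrite -t0; exact: ndt. Qed.

Let cell (A0 : set R) (A : nat -> set R) : set T :=
  X0 @^-1` A0 `&` \bigcap_(i in `I_n) (inc i @^-1` A i).

Let cell_prob A0 A : measurable A0 -> (forall i, measurable (A i)) ->
  P (cell A0 A) = (P (X0 @^-1` A0) * \prod_(i < n) P (inc i @^-1` A i))%E.
Proof.
move=> mA0 mA; rewrite /cell iX0//; last first.
  rewrite /process_sigma_algebra; set G := (X in <<s X >>).
  pose T' := g_sigma_algebraType G.
  have mB s : 0 <= s -> measurable_fun setT (B s : T' -> R).
    move=> s0 _ D mD; rewrite setTI; apply: sub_sigma_algebra.
    by exists s => //; exists D.
  suff : measurable (\bigcap_(i in `I_n) (inc i @^-1` A i) : set T') by [].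
  apply: bigcap_measurableType => i _; apply: measurable_preimage => //.
  by apply: measurable_funB; exact: mB.
by rewrite (brownian_independent_increments bB)// t0.
Qed.

(** A pi-system generating the information carried by X0 and all grid increments except the k-th,
    whose constraint is overwritten by [setT]. *)
Definition grid_cells : set_system T :=
  [set E | exists A0 (A : nat -> set R), [/\ measurable A0,
     forall i, measurable (A i) & E = cell A0 (fun i => if i == k then setT else A i)]].

Lemma grid_cells_measurable : grid_cells `<=` measurable.
Proof.
move=> _ [A0 [A [mA0 mA ->]]]; apply: measurableI; first exact: measurable_preimage.
apply: bigcap_measurableType => i _; apply: measurable_preimage.
  exact: measurable_increment.
by case: ifP.
Qed.

Lemma grid_cells_independent E C : <<s grid_cells >> E -> measurable C ->
  P (E `&` inc k @^-1` C) = (P E * P (inc k @^-1` C))%E.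
Proof.
move=> GE mC; apply: (independent_sigma_algebra _ _ _ _ _ GE).
- exact: grid_cells_measurable.
- move=> _ _ [A0 [A [mA0 mA ->]]] [A0' [A' [mA0' mA' ->]]].
  exists (A0 `&` A0'), (fun i => A i `&` A' i); split.
  + exact: measurableI.
  + by move=> i; exact: measurableI.
  + rewrite /cell preimage_setI; apply/seteqP; split=> w /=.
      move=> [[a h] [a' h']]; split => // i iln.
      by move: (h i iln) (h' i iln); case: ifP.
    move=> [[a a'] h]; split; split => // i iln; move: (h i iln); case: ifP => //.
      by move=> _ [].
    by move=> _ [].
- exists setT, (fun=> setT); split => //.
  by apply/seteqP; split => // w _; split => // i _ /=; case: ifP.
- by apply: measurable_preimage => //; exact: measurable_increment.
move=> _ [A0 [A [mA0 mA ->]]].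
have -> : cell A0 (fun i => if i == k then setT else A i) `&` inc k @^-1` C =
    cell A0 (fun i => if i == k then C else A i).
  apply/seteqP; split=> w /=.
    move=> [[a h] c]; split => // i iln; move: (h i iln).
    by case: eqVneq => [->|].
  move=> [a h]; split; last by have := h k kn; rewrite /= eqxx.
  by split => // i iln; move: (h i iln); case: eqVneq => [->|].
rewrite !cell_prob//; last 2 first.
- by move=> i; case: ifP.
- by move=> i; case: ifP.
rewrite (bigD1 (Ordinal kn))//= eqxx.
rewrite [X in (_ = P _ * X * _)%E](bigD1 (Ordinal kn))//= eqxx.
rewrite preimage_setT probability_setT mul1e -muleA; congr (_ * _)%E.
rewrite muleC; congr (_ * _)%E; apply: eq_bigr => i.
by rewrite -val_eqE /= => /negbTE ->.
Qed.

Let T' := g_sigma_algebraType grid_cells.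

Lemma grid_measurable_increment i : (i < n)%N -> i != k ->
  measurable_fun setT (inc i : T' -> R).
Proof.
move=> iln ik _ D mD; rewrite setTI; apply: sub_sigma_algebra.
exists setT, (fun j => if j == i then D else setT); split => //.
  by move=> j; case: ifP.
apply/seteqP; split=> w /=.
  move=> Dw; split => // j _ /=; case: ifP => // _.
  by case: eqVneq => [->|].
by move=> [_ /(_ i iln)] /=; rewrite (negbTE ik) eqxx.
Qed.

Lemma grid_measurable_initial : measurable_fun setT (X0 : T' -> R).
Proof.
move=> _ D mD; rewrite setTI; apply: sub_sigma_algebra.
exists D, (fun=> setT); split => //.
apply/seteqP; split=> w /=; last by case.
by move=> Dw; split => // i _ /=; case: ifP.
Qed.

Lemma grid_measurable_past j : (j <= k)%N ->
  measurable_fun setT (B (t j) : T' -> R).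
Proof.
elim: j => [_|j IH jk].
  rewrite t0 (_ : (B 0 : T' -> R) = cst 0); first exact: measurable_cst.
  by apply/funext => w; rewrite (brownian_start bB).
rewrite (_ : (B (t j.+1) : T' -> R) = (B (t j) : T' -> R) \+ (inc j : T' -> R)).
  apply: measurable_funD; first by apply: IH; exact: ltnW.
  by apply: grid_measurable_increment; rewrite ?(ltn_trans jk)// ltn_eqF.
by apply/funext => w /=; rewrite /inc /increment addrC subrK.
Qed.

Lemma grid_measurable_future j : (k < j <= n)%N ->
  measurable_fun setT (increment B (t k.+1) (t j) : T' -> R).
Proof.
elim: j => [|j IH /andP[kj jn]]; first by rewrite ltn0.
move: kj; rewrite ltnS leq_eqVlt => /predU1P[<-|kj].
  rewrite (_ : (increment B _ _ : T' -> R) = cst 0); first exact: measurable_cst.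
  by apply/funext => w; rewrite /increment subrr.
rewrite (_ : (increment B _ _ : T' -> R) =
   (increment B (t k.+1) (t j) : T' -> R) \+ (inc j : T' -> R)).
  apply: measurable_funD; first by apply: IH; rewrite kj ltnW.
  by apply: grid_measurable_increment; rewrite // gtn_eqF.
by apply/funext => w /=; rewrite /inc /increment; lra.
Qed.

End grid.

(* [S] restricts the times: a finite [S] only involves the increments over a
   finite grid. *)
Definition outside_events (a b : R) (S : set R) : set_system T :=
  [set E | exists2 A, measurable A & [\/ E = X0 @^-1` A,
     exists2 s, S s /\ 0 <= s <= a & E = B s @^-1` A |
     exists2 s, S s /\ b <= s & E = increment B b s @^-1` A]].

Lemma outside_events_finite_independent a b (L : seq R) E C :
  0 <= a -> a <= b -> <<s outside_events a b [set` L] >> E -> measurable C ->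
  P (E `&` increment B a b @^-1` C) = (P E * P (increment B a b @^-1` C))%E.
Proof.
move=> a0 ab EL mC.
pose p := sort <=%R [seq s <- L | 0 <= s <= a].
pose f := sort <=%R [seq s <- L | b <= s].
(* The points a and b are consecutive in the grid, so the increment from a to b is one grid
   increment, of index k below. *)
pose g := 0 :: p ++ a :: b :: f.
have pP s : s \in p -> 0 <= s <= a by rewrite mem_sort mem_filter => /andP[].
have fP s : s \in f -> b <= s by rewrite mem_sort mem_filter => /andP[].
have tr : transitive (<=%R : rel R) by exact: le_trans.
have sp : pairwise <=%R p by rewrite -sorted_pairwise//; exact: sort_le_sorted.
have sf : pairwise <=%R f by rewrite -sorted_pairwise//; exact: sort_le_sorted.
have sg : sorted <=%R g.
  rewrite sorted_pairwise// /g pairwise_cons; apply/andP; split.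
    apply/allP => s; rewrite mem_cat !inE => /or4P[/pP/andP[]//|/eqP->//|/eqP->|/fP].
      exact: le_trans ab.
    by apply: le_trans; exact: le_trans ab.
  rewrite pairwise_cat sp /= sf ab /= andbT; apply/and3P; split.
  - apply/allrelP => x y /pP/andP[_ xa]; rewrite !inE => /or3P[/eqP->//|/eqP->|/fP].
      exact: le_trans ab.
    by apply: le_trans; exact: le_trans ab.
  - by apply/allP => s /fP; exact: le_trans.
  - by apply/allP => s /fP.
(* Past its last point the grid is continued by a constant, because the independence of increments
   is stated for infinite nondecreasing sequences. *)
pose n := (size g).-1; pose t i := nth 0 g (minn i n).
have sgE : size g = n.+1 by [].
have ndt : nondecreasing_seq t.
  move=> i j ij; apply: (sorted_leq_nth tr (@lexx _ _)) => //.
  - by rewrite inE sgE ltnS geq_minr.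
  - by rewrite inE sgE ltnS geq_minr.
  - by rewrite leq_min geq_minr andbT (leq_trans _ ij)// geq_minl.
pose k := (size p).+1.
have nE : n = (k + (size f).+1)%N by rewrite /n /= size_cat /= addnS.
have kn : (k < n)%N by rewrite nE -addn1 leq_add2l.
have tk : t k = a.
  by rewrite /t (minn_idPl (ltnW kn)) /k /g /= nth_cat ltnn subnn.
have tk1 : t k.+1 = b.
  by rewrite /t (minn_idPl kn) /k /g /= nth_cat ltnNge leqnSn /= subSnn.
have t0 : t 0%N = 0 by rewrite /t min0n.
rewrite -tk -tk1; apply: (grid_cells_independent t0 ndt kn) => //.
move: E EL; apply: smallest_sub; first exact: smallest_sigma_algebra.
move=> E [A mA]; pose T' := g_sigma_algebraType (grid_cells t n k).
have pre (h : T' -> R) : measurable_fun setT h ->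
    <<s grid_cells t n k >> (h @^-1` A).
  by move=> mh; have := mh measurableT A mA; rewrite setTI.
move=> [->|[s [sL s0a] ->]|[s [sL sb] ->]].
- by apply: pre; exact: grid_measurable_initial.
- have sp' : s \in p by rewrite mem_sort mem_filter s0a.
  have ip : (index s p < size p)%N by rewrite index_mem.
  have -> : s = t (index s p).+1.
    rewrite /t (minn_idPl _) /g /= ?nth_cat ?ip ?nth_index//.
    by apply: leq_trans (ltnW kn); rewrite /k ltnS ltnW.
  apply: pre; apply: grid_measurable_past => //.
  by rewrite /k ltnS ltnW.
- have sf' : s \in f by rewrite mem_sort mem_filter sb.
  have jf : (index s f < size f)%N by rewrite index_mem.
  have E1 : (k.+1 + index s f).+1 = (size p + (index s f).+3)%N.
    by rewrite /k !addnS !addSn.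
  have -> : s = t (k.+1 + index s f).+1.
    rewrite E1 /t (minn_idPl _); last by rewrite nE /k addSnnS leq_add2l !ltnS.
    rewrite /g addnS /= nth_cat ltnNge.
    by rewrite leq_addr /= addKn /= nth_index.
  rewrite -tk1; apply: pre; apply: grid_measurable_future => //.
  rewrite nE /k; apply/andP; split; last by rewrite addSnnS -addnS leq_add2l !ltnS.
  by rewrite ltnS leqW// leq_addr.
Qed.

(** The events determined by finitely many times form a pi-system that generates the full
    sigma-algebra. Asking in [fin] for membership with every larger list of times makes closure
    under intersection immediate: concatenate the lists. *)
Lemma outside_events_independent a b E C : 0 <= a -> a <= b ->
  <<s outside_events a b setT >> E -> measurable C ->
  P (E `&` increment B a b @^-1` C) = (P E * P (increment B a b @^-1` C))%E.
Proof.
move=> a0 ab sE mC.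
pose fin : set_system T := [set F | exists L : seq R, forall L' : seq R,
  {subset L <= L'} -> <<s outside_events a b [set` L'] >> F].
have finI : setI_closed fin.
  move=> F F' [L HL] [L' HL']; exists (L ++ L') => L2 sub.
  pose T' := g_sigma_algebraType (outside_events a b [set` L2]).
  apply: (@measurableI _ T').
    by apply: HL => s sL; apply: sub; rewrite mem_cat sL.
  by apply: HL' => s sL; apply: sub; rewrite mem_cat sL orbT.
have finP F : fin F -> <<s outside_events a b setT >> F.
  move=> [L /(_ L (fun _ => id))]; apply: sub_sigma_algebra2 => {}F [A mA H].
  by exists A => //; case: H => [?|[s [? ?] ?]|[s [? ?] ?]];
    [apply: Or31|apply: Or32; exists s|apply: Or33; exists s].
have outm : outside_events a b setT `<=` measurable.
  move=> F [A mA] [->|[s _ ->]|[s _ ->]]; apply: measurable_preimage => //.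
  exact: measurable_increment.
have outfin : outside_events a b setT `<=` fin.
  move=> F [A mA [FE|[s [_ sa] FE]|[s [_ bs] FE]]].
  - by exists [::] => L' _; apply: sub_sigma_algebra; exists A => //; apply: Or31.
  - exists [:: s] => L' sub; apply: sub_sigma_algebra; exists A => //.
    apply: Or32; exists s => //; split => //=.
    by apply: sub; rewrite inE.
  - exists [:: s] => L' sub; apply: sub_sigma_algebra; exists A => //.
    apply: Or33; exists s => //; split => //=.
    by apply: sub; rewrite inE.
have finm : fin `<=` measurable.
  move=> F /finP; apply: smallest_sub => //; exact: sigma_algebra_measurable.
apply: (@independent_sigma_algebra _ _ _ P fin) => //.
- by exists [::] => L' _; exact: (@measurableT _ (g_sigma_algebraType _)).
- by apply: measurable_preimage => //; exact: measurable_increment.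
- move=> F [L HL]; apply: (@outside_events_finite_independent a b L) => //.
  by apply: HL.
- by move: sE; apply: sub_sigma_algebra2.
Qed.

End independence.

(** * The normal law and Fubini for independent variables *)

Section normal_facts.
Context {R : realType}.
Implicit Types (s c : R) (A : set R).

Lemma normal_prob_set1 s c : normal_prob 0 s [set c] = 0%E.
Proof.
have := normal_prob_dominates 0 s => /null_content_dominatesP; apply => //.
exact: lebesgue_measure_set1.
Qed.

Lemma normal_pdfN s x : s != 0 -> normal_pdf 0 s (- x) = normal_pdf 0 s x.
Proof. by move=> s0; rewrite !normal_pdfE// /normal_fun !subr0 sqrrN. Qed.

Lemma normal_probN s A : s != 0 -> measurable A ->
  normal_prob 0 s ((-%R : R -> R) @^-1` A) = normal_prob 0 s A.
Proof.
move=> s0 mA; have mN : measurable_fun setT (-%R : R -> measurableTypeR R).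
  exact: oppr_measurable.
rewrite /normal_prob.
transitivity (\int[pushforward lebesgue_measure (-%R : R -> measurableTypeR R)]_(x in A)
    (normal_pdf 0 s x)%:E)%E.
  rewrite ge0_integral_pushforward//.
  - by apply: eq_integral => x _ /=; rewrite normal_pdfN.
  - apply/measurable_EFinP; apply: measurable_funTS; exact: measurable_normal_pdf.
  - by move=> x _; rewrite lee_fin normal_pdf_ge0.
by apply: eq_measure_integral => C mC _; exact: lebesgue_measureN.
Qed.

Lemma normal_prob_half s : s != 0 -> normal_prob 0 s `[0, +oo[ = (1 / 2)%:E.
Proof.
move=> s0; set q := normal_prob _ _ _.
have h1 : normal_prob 0 s `]-oo, 0] = q.
  rewrite -normal_probN//; congr (normal_prob 0 s _).
  by apply/seteqP; split=> x; rewrite /= !in_itv/= ?andbT; lra.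
have h2 : normal_prob 0 s `]-oo, 0[ = q.
  rewrite -h1 -(@setUitv1 _ _ -oo%O 0 true)//= measureU//= ?normal_prob_set1 ?adde0//.
  by apply/seteqP; split => // x [] /=; rewrite in_itv/= => xl xE; move: xl; rewrite xE ltxx.
have h3 : (q + q = 1)%E.
  rewrite -{2}h2 -(probability_setT (normal_prob 0 s)) -measureU//.
    congr (normal_prob 0 s _); apply/seteqP; split => // x _ /=; rewrite !in_itv/=.
    by rewrite andbT; case: (leP 0 x) => ?; [left|right].
  apply/seteqP; split => // x [] /=; rewrite !in_itv/= andbT.
  by move=> /le_lt_trans /[apply]; rewrite ltxx.
have qf : q \is a fin_num by exact: fin_num_measure.
move: h3; rewrite -(fineK qf) -EFinD => -[h3]; congr (_%:E); lra.
Qed.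

Lemma normal_prob_tail_gt0 s c : s != 0 -> (0 < normal_prob 0 s `[c, +oo[)%E.
Proof.
move=> s0.
have [x0 _ xmin] := @EVT_min R (normal_pdf 0 s) c (c + 1) ltac:(lra)
  (continuous_subspaceT (@continuous_normal_pdf R 0 s s0)).
have m0 : 0 < normal_pdf 0 s x0.
  by rewrite normal_pdfE// mulr_gt0 ?normal_peak_gt0// expR_gt0.
apply: (@lt_le_trans _ _ (normal_prob 0 s `[c, c + 1])); last first.
  by apply: le_measure; rewrite ?inE//; apply: subset_itvl.
apply: (@lt_le_trans _ _ (\int[lebesgue_measure]_(x in `[c, (c + 1)%R]) (normal_pdf 0 s x0)%:E)%E).
  rewrite integral_cst//= lebesgue_measure_itv/= lte_fin.
  rewrite ifT; last lra.
  by rewrite -EFinD -EFinM lte_fin mulr_gt0//; lra.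
apply: ge0_le_integral => //=.
- by move=> x _; rewrite lee_fin ltW.
- apply/measurable_EFinP; apply: measurable_funTS; exact: measurable_normal_pdf.
Qed.

End normal_facts.

Section restricted_law.
Context {R : realType} d (T : measurableType d) (P : probability T R).
Context d' (T' : measurableType d').

(** The law of Y on the event A, left unnormalized so that A may be null. *)
Definition restricted_law (A : set T) (Y : T -> T') of measurable A &
  measurable_fun setT Y : set T' -> \bar R := fun D => P (Y @^-1` D `&` A).

Variables (A : set T) (Y : T -> T').
Hypotheses (mA : measurable A) (mY : measurable_fun setT Y).

Let nu : {measure set T' -> \bar R} :=
  measure_function_pushforward__canonical__measure_function_Measure (mrestr P mA) mY.

Let nu_fin : fin_num_fun (restricted_law mA mY).
Proof.
move=> D mD; apply: fin_num_measure; apply: measurableI => //.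
exact: measurable_preimage.
Qed.

HB.instance Definition _ := isMeasure.Build _ _ _ (restricted_law mA mY)
  (measure0 nu) (measure_ge0 nu) (@measure_semi_sigma_additive _ _ _ nu).

HB.instance Definition _ :=
  @Measure_isFinite.Build _ _ _ (restricted_law mA mY) nu_fin.

End restricted_law.

Section fubini.
Context {R : realType} d (T : measurableType d) (P : probability T R).

(** The hypothesis on rectangles says that on A the joint law of (W, Y) is the product of Q and the
    restricted law of Y; the formula integrates the sections of S. *)
Lemma independent_fubini (A : set T) (W Y : T -> R)
    (Q : {sigma_finite_measure set R -> \bar R}) (S : set (R * R)) :
  measurable A -> measurable_fun setT W -> measurable_fun setT Y ->
  (forall C D : set R, measurable C -> measurable D ->
    P (A `&` (Y @^-1` D) `&` W @^-1` C) = (P (A `&` Y @^-1` D) * Q C)%E) ->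
  measurable S ->
  P (A `&` [set w | S (W w, Y w)]) =
    (\int[Q]_x P (A `&` [set w | S (x, Y w)]))%E.
Proof.
move=> mA mW mY ind mS.
have mWY : measurable_fun setT (fun w => (W w, Y w)) by exact: measurable_fun_pair.
have E := @product_measure_unique _ _ _ _ R Q (restricted_law P mA mY)
  (restricted_law P mA mWY).
rewrite setIC -[LHS]/(restricted_law P mA mWY S) -E//.
  rewrite /product_measure1; apply: eq_integral => x _ /=.
  rewrite /restricted_law setIC; congr (P (_ `&` _)); apply/seteqP; split=> w;
    by rewrite /xsection /= in_setE.
move=> C D mC mD; rewrite [RHS]muleC /= /restricted_law [X in (P X * _)%E]setIC -ind//.
by congr (P _); apply/seteqP; split=> w /=; tauto.
Qed.

End fubini.

(** * Path properties of Brownian motion *)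

Section brownian_paths.
Context {R : realType} d (T : measurableType d) (P : probability T R).
Variables (X0 : T -> R) (B : R -> {RV P >-> R}).
Hypotheses (bB : brownian_motion B) (mX0 : measurable_fun setT X0).
Hypothesis iX0 : independent_of_process P X0 B.

Local Notation pr := (pr P).

(** Paths are continuous only on [0, +oo[. Composition with the 1-Lipschitz map t |-> max t q yields
    functions continuous on the whole line. *)
Lemma brownian_max_continuous (q : R) w : 0 <= q ->
  continuous (fun t : R => B (Num.max t q) w : R).
Proof.
move=> q0 t; have tq : 0 <= Num.max t q by rewrite le_max q0 orbT.
have /subspace_continuousP/(_ (Num.max t q)) :
  {within `[0, +oo[, continuous (fun t : R => B t w : R)} by exact: (brownian_continuous bB).
rewrite /= in_itv/= andbT tq => /(_ isT)/cvgrPdist_lt H.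
apply/cvgrPdist_lt => e /H; rewrite /within/= => -[r /= r0 Hr].
exists r => //= u; rewrite /= => tu; apply: Hr => /=.
  apply: le_lt_trans tu; rewrite /Num.max.
  by case: ltP => h1; case: ltP => h2 //; rewrite ?subrr ?normr0//;
    rewrite ler_norml; have := ler_norm (t - u); have := ler_norm (u - t);
    rewrite (distrC u t) => *; apply/andP; split; lra.
by rewrite in_itv/= andbT le_max q0 orbT.
Qed.

Lemma particle_continuous (X : T -> R) w : continuous (particle X B ^~ w).
Proof.
by move=> t; apply: cvgD; [exact: cvg_cst|exact: brownian_max_continuous].
Qed.

Lemma measurable_particle (X : T -> R) s : measurable_fun setT X ->
  measurable_fun setT (particle X B s).
Proof. by move=> mX; apply: measurable_funD. Qed.

Lemma particle_ge0 (X : T -> R) s w : 0 <= s -> particle X B s w = X w + B s w.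
Proof. by move=> s0; rewrite /particle (max_idPl _). Qed.

Lemma particle0 (X : T -> R) w : particle X B 0 w = X w.
Proof. by rewrite particle_ge0// (brownian_start bB) addr0. Qed.

Lemma increment0 s w : increment B 0 s w = B s w.
Proof. by rewrite /increment (brownian_start bB) subr0. Qed.

Lemma increment_law (a b : R) (A : set R) : 0 <= a -> a < b -> measurable A ->
  P (increment B a b @^-1` A) = normal_prob 0 (Num.sqrt (b - a)) A.
Proof. by move=> a0 ab mA; rewrite (brownian_gaussian bB). Qed.

Lemma sqrt_sub_neq0 (a b : R) : a < b -> Num.sqrt (b - a) != 0.
Proof. by move=> ab; rewrite gt_eqF// sqrtr_gt0; lra. Qed.

Local Notation outside a b :=
  (g_sigma_algebraType (outside_events X0 B a b setT)).

Lemma outside_events_measurable a b (E : set T) :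
  <<s outside_events X0 B a b setT >> E -> measurable E.
Proof.
apply: smallest_sub; first exact: sigma_algebra_measurable.
move=> F [A mA] [->|[s _ ->]|[s _ ->]]; apply: measurable_preimage => //.
exact: measurable_increment.
Qed.

Lemma outside_measurable_initial a b :
  measurable_fun setT (X0 : outside a b -> R).
Proof.
move=> _ A mA; rewrite setTI; apply: sub_sigma_algebra.
by exists A => //; apply: Or31.
Qed.

Lemma outside_measurable_past a b s : 0 <= s <= a ->
  measurable_fun setT (B s : outside a b -> R).
Proof.
move=> sa _ A mA; rewrite setTI; apply: sub_sigma_algebra.
by exists A => //; apply: Or32; exists s.
Qed.

Lemma outside_measurable_future a b s : b <= s ->
  measurable_fun setT (increment B b s : outside a b -> R).
Proof.
move=> bs _ A mA; rewrite setTI; apply: sub_sigma_algebra.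
by exists A => //; apply: Or33; exists s.
Qed.

(** Y is independent of the increment, so by Fubini the probability is an average of the masses that
    a normal law gives to points. *)
Lemma outside_no_atom a b (Y : T -> R) : 0 <= a -> a < b ->
  measurable_fun setT (Y : outside a b -> R) ->
  P [set w | Y w = increment B a b w] = 0%E.
Proof.
move=> a0 ab mY'; have mY : measurable_fun setT Y.
  move=> _ A mA; rewrite setTI; apply: (@outside_events_measurable a b).
  by have := mY' measurableT A mA; rewrite setTI.
pose S : set (R * R) := [set p | p.1 = p.2].
have mS : measurable S.
  rewrite (_ : S = (fun p => p.1 - p.2) @^-1` [set 0]).
    apply: measurable_preimage => //.
    by apply: measurable_funB; [exact: measurable_fst|exact: measurable_snd].
  apply/seteqP; split=> -[x y]; rewrite /S /=; first by move=> ->; rewrite subrr.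
  by move=> /eqP; rewrite subr_eq0 => /eqP.
have mI := @measurable_increment _ _ _ P B a b.
have := @independent_fubini _ _ T P setT Y (increment B a b)
  (restricted_law P measurableT mY) S measurableT mY mI _ mS.
rewrite setTI => ->.
  apply: integral0_eq => x _; rewrite setTI.
  rewrite (_ : [set w | _] = increment B a b @^-1` [set x]).
    by rewrite increment_law// normal_prob_set1.
  by apply/seteqP; split=> w; rewrite /S/= => ->.
move=> C D mC mD; have sC : <<s outside_events X0 B a b setT >> (Y @^-1` C).
  by have := mY' measurableT C mC; rewrite setTI.
rewrite !setTI setIC (outside_events_independent bB mX0 iX0 a0 (ltW ab) sC mD) muleC.
by congr (_ * P _)%E; rewrite setIT.
Qed.

Lemma particle_no_atom (t c : R) : 0 < t -> pr [set w | particle X0 B t w = c] = 0.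
Proof.
move=> t0; rewrite /pr (_ : [set w | _] = [set w | c - X0 w = increment B 0 t w]).
  rewrite outside_no_atom//; apply: measurable_funB => //.
  exact: outside_measurable_initial.
by apply/seteqP; split=> w /=; rewrite increment0 particle_ge0 ?(ltW t0)//; lra.
Qed.

Definition stays_ge0 (t : R) : set T := ~` hits_lt (particle (cst 0) B) (cst 0) 0 t.

Lemma stays_ge0P t w : stays_ge0 t w <-> forall s, 0 <= s <= t -> 0 <= B s w.
Proof.
split=> [H s /andP[s0 st]|H [s /andP[s0 st]]].
  rewrite leNgt; apply/negP => Bs; apply: H; exists s; first by rewrite s0.
  by rewrite particle_ge0 ?add0r.
by rewrite particle_ge0 ?add0r// ltNge H ?s0.
Qed.

Lemma stays_ge0_measurable t : measurable (stays_ge0 t).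
Proof.
apply: measurableC; apply: measurable_hits_lt => //.
- exact: particle_continuous.
- by move=> s _; apply: measurable_particle; exact: measurable_cst.
Qed.

Lemma stays_ge0_past a b t : t <= a ->
  <<s outside_events X0 B a b setT >> (stays_ge0 t).
Proof.
move=> ta; apply: (@measurableC _ (outside a b)).
apply: (@measurable_hits_lt R _ (outside a b)) => //.
- exact: particle_continuous.
- move=> s /andP[s0 st]; apply: measurable_funD; first exact: measurable_cst.
  by rewrite (max_idPl s0); apply: outside_measurable_past; rewrite s0 (le_trans st).
Qed.

Lemma brownian_small_near0 (c e : R) : 0 < c -> 0 < e ->
  exists N, forall n, (N <= n)%N -> pr [set w | c < `|B n.+1%:R^-1 w|] < e.
Proof.
move=> c0 e0.
have mA n : measurable [set w | c < `|B n.+1%:R^-1 w|].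
  rewrite (_ : [set w | _] = (fun w => `|B n.+1%:R^-1 w|) @^-1` `]c, +oo[%classic).
    by apply: measurable_preimage => //; exact: measurableT_comp.
  by apply/seteqP; split=> w; rewrite /= in_itv/= andbT.
pose F n := \bigcup_(m in [set m | (n <= m)%N]) [set w | c < `|B m.+1%:R^-1 w|].
have mF n : measurable (F n) by apply: bigcup_measurable => m _.
have [||N] := pr_dec P e0 (@measurable0 _ T) mF.
- by move=> m n mn w [k /= nk ?]; exists k => //=; exact: leq_trans nk.
- move=> w H; have := @brownian_max_continuous 0 w (lexx 0).
  move=> /(@continuous_eps R _ 0 c)/(_ c0)[r r0 Hr].
  have [n nr] := invSn_small r0.
  have [m /= nm cm] := H n I.
  have m0 : 0 < m.+1%:R^-1 :> R := invSn_gt0 m.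
  have := Hr m.+1%:R^-1; rewrite subr0 gtr0_norm//.
  rewrite (max_idPl (ltW m0)) maxxx (brownian_start bB) subr0.
  move=> /(_ (le_lt_trans (invSn_le nm) nr)).
  by rewrite ltNge (ltW cm).
rewrite pr_set0 add0r => HN.
exists N => n Nn; apply: le_lt_trans HN; apply: pr_le => // w cw.
by exists n.
Qed.

(* Blumenthal-type argument: the germ event [F0] that [B] is nonnegative near
   [0] is independent of increments that approximate [B s], so that
   [P F0 <= P F0 / 2]. *)
Lemma stays_ge0_null (t : R) : 0 < t -> pr (stays_ge0 t) = 0.
Proof.
move=> t0; pose F0 := \bigcup_n stays_ge0 n.+1%:R^-1.
have mF := stays_ge0_measurable.
have mF0 : measurable F0 by apply: bigcupT_measurable.
have F_nd m n : (m <= n)%N -> stays_ge0 m.+1%:R^-1 `<=` stays_ge0 n.+1%:R^-1.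
  move=> mn w /stays_ge0P H; apply/stays_ge0P => s /andP[s0 sn].
  by apply: H; rewrite s0 (le_trans sn)// invSn_le.
have F0_tail n : F0 = \bigcup_m stays_ge0 (n + m).+1%:R^-1.
  apply/seteqP; split=> w [m _ Hm]; last by exists (n + m)%N.
  by exists m => //; apply: F_nd Hm; exact: leq_addl.
have FF0 s : 0 < s -> stays_ge0 s `<=` F0.
  move=> s0 w /stays_ge0P H; have [n ns] := invSn_small s0.
  exists n => //; apply/stays_ge0P => u /andP[u0 un]; apply: H.
  by rewrite u0 (le_trans un)// ltW.
have mB s (A : set R) : measurable A -> measurable (B s @^-1` A).
  by move=> mA; apply: measurable_preimage.
have key s e : 0 < s -> 0 < e -> pr (stays_ge0 s) <= pr F0 / 2 + 3 * e.
  move=> s0 e0.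
  have [k Hk] : exists k, pr (B s @^-1` `[- (2 * k.+1%:R^-1), +oo[) < 1 / 2 + e.
    have half : pr (B s @^-1` `[0, +oo[) = 1 / 2.
      have := @increment_law 0 s `[0, +oo[%classic (lexx 0) s0 (measurable_itv _).
      rewrite normal_prob_half ?sqrt_sub_neq0// => /(congr1 fine)/= <-.
      congr (fine (P _)); apply/funext => w.
      by rewrite /preimage/= increment0.
    rewrite -half; apply: pr_dec => //; try by move=> *; apply: mB.
    - move=> m n mn w /=; rewrite !in_itv/= !andbT; apply: le_trans.
      by rewrite lerN2 ler_pM2l// invSn_le.
    - move=> w H; rewrite /= in_itv/= andbT leNgt; apply/negP => Bw.
      have [n Hn] := invSn_small (ltac:(lra) : 0 < - B s w / 2).
      have := H n I; rewrite /= in_itv/= andbT.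
      by move: (_^-1) Hn => c ? ?; lra.
  (* Outside the unlikely event |B a| > c, B s >= 0 forces the increment from a to s above -c, and
     such an increment forces B s >= -2 c, whose probability is close to 1 / 2. *)
  set c := k.+1%:R^-1 in Hk; have c0 : 0 < c := invSn_gt0 k.
  have [N HN] := brownian_small_near0 c0 e0.
  have [N' HN'] := invSn_small s0.
  pose n := maxn N N'; have /HN Hn : (N <= n)%N by rewrite leq_maxl.
  pose a : R := n.+1%:R^-1; rewrite -/a in Hn.
  have a0 : 0 < a := invSn_gt0 n.
  have as_ : a < s by apply: le_lt_trans HN'; apply: invSn_le; rewrite leq_maxr.
  set G := [set w | c < `|B a w|] in Hn.
  have mG : measurable G.
    rewrite (_ : G = (fun w => `|B a w|) @^-1` `]c, +oo[%classic).
      by apply: measurable_preimage => //; exact: measurableT_comp.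
    by apply/seteqP; split=> w; rewrite /G/= in_itv/= andbT.
  pose D := increment B a s @^-1` `[- c, +oo[.
  have mD : measurable D.
    by apply: measurable_preimage => //; exact: measurable_increment.
  have F0D : pr (F0 `&` D) = pr F0 * pr D.
    apply: EFin_inj; rewrite EFinM -!prE//; last exact: measurableI.
    apply: (outside_events_independent bB mX0 iX0); rewrite ?(ltW a0) ?(ltW as_)//.
    (* Dropping the first n terms of the union shows that the germ event depends on the path up to
       time a only. *)
    rewrite (F0_tail n); apply: (@bigcupT_measurable _ (outside a s)) => m.
    by apply: stays_ge0_past; apply: invSn_le; exact: leq_addr.
  have h1 : pr (stays_ge0 s) <= pr (F0 `&` D) + pr G.
    apply: pr_cover => //; first exact: measurableI.
    move=> w Fw; have [|Gw] := pselect (G w); first by right.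
    left; split; first exact: (FF0 s).
    move: Fw => /stays_ge0P/(_ s); rewrite lexx (ltW s0) => /(_ isT) Bs.
    rewrite /D/= in_itv/= andbT /increment.
    move/negP: Gw; rewrite -leNgt => Ga.
    by have := ler_norm (B a w); lra.
  have h2 : pr D <= pr (B s @^-1` `[- (2 * c), +oo[) + pr G.
    apply: pr_cover => //; first exact: mB.
    move=> w; rewrite /D/= !in_itv/= !andbT /increment => Dw.
    have [|Gw] := pselect (G w); [by right|left].
    move/negP: Gw; rewrite -leNgt => Ga.
    by have := ler_norm (- B a w); rewrite normrN; lra.
  have q0 := pr_ge0 P F0; have q1 := pr_le1 P mF0.
  rewrite F0D in h1.
  have : pr F0 * pr D <= pr F0 * (1 / 2 + 2 * e).
    by apply: ler_wpM2l => //; lra.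
  have : pr F0 * e <= e by nra.
  lra.
have q0 := pr_ge0 P F0.
have q_le0 : pr F0 <= 0.
  apply/ler_addgt0Pr => e e0.
  have [n Hn] := pr_inc P (ltac:(lra) : 0 < e / 8) mF0 (fun n => mF n.+1%:R^-1) F_nd
    (@subset_refl _ F0).
  have := key n.+1%:R^-1 (e / 8) (invSn_gt0 n) ltac:(lra).
  lra.
apply/eqP; rewrite eq_le pr_ge0 andbT.
by apply: le_trans q_le0; apply: pr_le => //; exact: FF0.
Qed.

End brownian_paths.

(** * Touching a boundary and instantaneous losses *)

(** Without the cap y the sum is at least (delta - x) + (delta + x), and an active cap alone
    contributes y > 2 * delta. The larger bound for x >= y makes the final inequality strict. *)
Lemma clipped_symmetric_sum (R : realType) (delta y x : R) :
  0 <= delta -> 2 * delta < y ->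
  let f z := Num.min (Num.max (delta - z) 0) y in
  2 * delta <= f x + f (- x) /\ (y <= x -> y <= f x + f (- x)).
Proof.
move=> d0 dy f; split=> [|yx]; rewrite /f /Num.min /Num.max;
  by do !case: ifPn; rewrite -?leNgt => *; lra.
Qed.

Section crossing.
Context {R : realType} d (T : measurableType d) (P : probability T R).
Variables (X0 : T -> R) (B : R -> {RV P >-> R}).
Hypotheses (bB : brownian_motion B) (mX0 : measurable_fun setT X0).
Hypothesis iX0 : independent_of_process P X0 B.

Local Notation pr := (pr P).
Local Notation Z := (particle X0 B).
Local Notation outside a b :=
  (g_sigma_algebraType (outside_events X0 B a b setT)).

Lemma particle_increment s u w : 0 <= s -> 0 <= u ->
  Z u w = Z s w + increment B s u w.
Proof. by move=> s0 u0; rewrite !particle_ge0// /increment; lra. Qed.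

Lemma measurable_hits_particle l a b : rcnd l -> measurable (hits Z l a b).
Proof.
move=> rl; apply: measurable_hits => //; first exact: particle_continuous.
by move=> s _; exact: measurable_particle.
Qed.

Lemma measurable_hits_lt_particle l a b : rcnd l -> measurable (hits_lt Z l a b).
Proof.
move=> [ml _]; apply: measurable_hits_lt => //; first exact: particle_continuous.
by move=> s _; exact: measurable_particle.
Qed.

Section level.
Variables (l : R -> R) (q t : R).
Hypotheses (rl : rcnd l) (q0 : 0 < q) (qt : q <= t).

Let gaps w := [set l s - X0 w - increment B q s w | s in `[q, t]].

Let gaps_has_sup w : has_sup (gaps w).
Proof.
split; first by exists (l q - X0 w - increment B q q w), q => //=; rewrite in_itv/= lexx.
have [c _ Hc] := @EVT_min R (fun s => B (Num.max s 0) w) q t qt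
  (continuous_subspaceT (brownian_max_continuous bB (lexx 0))).
exists (l t - X0 w - (B (Num.max c 0) w - B q w)) => _ [s /= sqt <-].
have := Hc s sqt; move: sqt; rewrite in_itv/= => /andP[qs st].
rewrite (max_idPl (le_trans (ltW q0) qs)) /increment.
by have := homo_leW rl.1 st; lra.
Qed.

(* The level that [B q] has to exceed for the particle not to hit [l] during
   [[q, t]]; it does not depend on the path up to time [q]. *)
Definition hitting_level (w : T) : R := sup (gaps w).

(** The level exceeds c exactly when the path started from c at time q strictly hits l, and that
    path is built from X0 and the increments after q. *)
Lemma hitting_level_measurable :
  measurable_fun setT (hitting_level : outside 0 q -> R).
Proof.
apply: (measurability _ (RGenOInfty.measurableE R)) => _ [_ [c ->] <-].
pose Y s w := (c + X0 w) + (B (Num.max s q) w - B q w).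
have cY w : continuous (Y ^~ w).
  move=> s; apply: cvgD; first exact: cvg_cst.
  by apply: cvgB; [apply: brownian_max_continuous (ltW q0) _|exact: cvg_cst].
rewrite setTI (_ : _ @^-1` _ = hits_lt Y l q t).
  apply: (@measurable_hits_lt R _ (outside 0 q)) => //.
    move=> s /andP[qs _]; apply: measurable_funD.
      by apply: measurable_funD => //; exact: outside_measurable_initial.
    by rewrite (max_idPl qs); exact: outside_measurable_future.
  exact: rl.1.
apply/seteqP; split=> w /=; rewrite in_itv/= andbT.
  move=> cw; have e0 : 0 < hitting_level w - c by lra.
  have [_ [s /= sqt <-] Hs] := sup_adherent e0 (gaps_has_sup w).
  move: sqt; rewrite in_itv/= => /andP[qs st].
  exists s; first by rewrite qs.
  by rewrite /Y (max_idPl qs); rewrite /hitting_level /increment in Hs *; lra.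
move=> [s /andP[qs st]]; rewrite /Y (max_idPl qs) => Hs.
apply: lt_le_trans (_ : l s - X0 w - increment B q s w <= _).
  by rewrite /increment; lra.
apply: sup_ubound; first exact: (gaps_has_sup w).2.
by exists s => //=; rewrite in_itv/= qs.
Qed.

(** Touching without crossing pins B q to a value that does not depend on it. *)
Lemma hitting_level_eq w : hits Z l q t w -> ~ hits_lt Z l q t w ->
  hitting_level w = increment B 0 q w.
Proof.
move=> [s /andP[qs st] zs] H; rewrite increment0//.
have E u : q <= u -> Z u w = X0 w + increment B q u w + B q w.
  move=> qu; rewrite particle_ge0; last by rewrite (le_trans _ qu) ?ltW.
  by rewrite /increment; lra.
apply/eqP; rewrite eq_le; apply/andP; split.
  apply: sup_le_ub; first exact: (gaps_has_sup w).1.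
  move=> _ [u /= + <-]; rewrite in_itv/= => /andP[qu ut].
  rewrite leNgt; apply/negP => Bu; apply: H; exists u; first by rewrite qu.
  by rewrite E//; lra.
apply: le_trans (_ : l s - X0 w - increment B q s w <= _).
  by rewrite E// in zs; lra.
apply: sup_ubound; first exact: (gaps_has_sup w).2.
by exists s => //=; rewrite in_itv/= qs.
Qed.

End level.

(** If the touching time is positive, some q k lies before it, and B (q k) equals an independent
    level: a null event. If the boundary is touched at time 0 and never crossed, then X0 <= l 0 <= l
    u <= X0 + B u, so B stays nonnegative on [0, t], which is null too. *)
Lemma touching_null l t : rcnd l -> 0 < t ->
  pr (hits Z l 0 t `\` hits_lt Z l 0 t) = 0.
Proof.
move=> rl t0; set D := _ `\` _.
have mD : measurable D.
  by apply: measurableD; [exact: measurable_hits_particle|exact: measurable_hits_lt_particle].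
pose q k : R := t * k.+1%:R^-1.
have q0 k : 0 < q k by rewrite mulr_gt0// invSn_gt0.
have qt k : q k <= t.
  by rewrite ger_pMr// invf_le1 ?ler1n.
pose E k := [set w | hitting_level l (q k) t w = increment B 0 (q k) w].
have negE : P.-negligible (\bigcup_k E k `|` stays_ge0 B t).
  apply: negligibleU.
    apply: negligible_bigcup => k.
    have mL := hitting_level_measurable rl (q0 k) (qt k).
    have mL' : measurable_fun setT (hitting_level l (q k) t).
      move=> _ A mA; rewrite setTI; apply: (@outside_events_measurable R d T P X0 B mX0 0 (q k)).
      by have := mL measurableT A mA; rewrite setTI.
    have mEk : measurable (E k).
      rewrite (_ : E k = (fun w => hitting_level l (q k) t w - increment B 0 (q k) w) @^-1` [set 0]).
        apply: measurable_preimage => //; apply: measurable_funB => //.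
        exact: measurable_increment.
      apply/seteqP; split=> w; rewrite /E /=; first by move=> ->; rewrite subrr.
      by move=> /eqP; rewrite subr_eq0 => /eqP.
    apply/negligibleP => //.
    exact: (outside_no_atom bB mX0 iX0 (lexx 0) (q0 k) mL).
  apply/negligibleP; first exact: stays_ge0_measurable.
  have := prE P (stays_ge0_measurable bB t).
  by rewrite (stays_ge0_null bB mX0 iX0 t0).
suff /negligibleP : P.-negligible D by move=> /(_ mD) D0; rewrite /pr D0.
apply: negligibleS negE => w [[s /andP[s0 st] zs] H].
have Hz u : 0 <= u <= t -> l u <= Z u w.
  by move=> ut; rewrite leNgt; apply/negP => zu; apply: H; exists u.
move: s0; rewrite le_eqVlt => /predU1P[s0|s0].
  right; apply/stays_ge0P => u /andP[u0 ut].
  rewrite -s0 particle0// in zs.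
  have := Hz u; rewrite u0 ut particle_ge0// => /(_ isT).
  by have := homo_leW rl.1 u0; lra.
left; have [k Hk] := invSn_small (ltac:(by rewrite divr_gt0) : 0 < s / t).
exists k => //; have qs : q k <= s.
  by rewrite /q mulrC -ler_pdivlMr// ltW.
apply: hitting_level_eq => //.
  by exists s => //; rewrite qs.
move=> [u /andP[qu ut]]; apply/negP; rewrite -leNgt; apply: Hz.
by rewrite ut andbT (le_trans _ qu)// ltW.
Qed.

(* A touching particle almost surely crosses, so that it is caught by the
   approximations. *)
Lemma hits_lower_semicontinuous (l : R -> R) (ls : nat -> R -> R)
    (eps : nat -> R) t h e :
  rcnd l -> (forall n, rcnd (ls n)) ->
  (forall m n s, (m <= n)%N -> ls m s <= ls n s) ->
  (forall m n, (m <= n)%N -> eps n <= eps m) ->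
  (forall c, 0 < c -> exists n, eps n <= c) ->
  (forall s u c, s < u -> 0 < c -> exists n, l s - c <= ls n u) ->
  0 <= t -> 0 < h -> 0 < e ->
  exists n, pr (hits Z l 0 t) - e <
    pr (hits (particle (fun w => X0 w + eps n) B) (ls n) 0 (t + h)).
Proof.
move=> rl rls lsm epsm eps0 lls t0 h0 e0.
pose F n := hits (particle (fun w => X0 w + eps n) B) (ls n) 0 (t + h).
have mF n : measurable (F n).
  apply: measurable_hits => //; first exact: particle_continuous.
  by move=> s _; apply: measurable_particle; exact: measurable_funD.
have th0 : 0 < t + h by lra.
have mG := measurable_hits_lt_particle 0 (t + h / 2) rl.
have [|//|n Hn] := pr_inc P e0 mG mF.
- move=> m n mn w [s s0 zs]; exists s => //.
  have := lsm _ _ s mn; have := epsm _ _ mn; move: zs; rewrite /particle; lra.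
- move=> w [s /andP[s0 st] zs].
  have c0 : 0 < (l s - Z s w) / 4 by lra.
  have [r r0 Hr] := continuous_eps s (@particle_continuous _ _ _ P B bB X0 w) c0.
  (* The functions [ls n] come close to l only after a positive delay, so the strict hit at s is
     witnessed slightly later, within the additional time h. *)
  pose u := s + Num.min (r / 2) (h / 2).
  have m0 : 0 < Num.min (r / 2) (h / 2) by rewrite lt_min; apply/andP; split; lra.
  have m1 : Num.min (r / 2) (h / 2) <= r / 2 by rewrite ge_min lexx.
  have m2 : Num.min (r / 2) (h / 2) <= h / 2 by rewrite ge_min lexx orbT.
  have su : s < u by rewrite /u; lra.
  have [n1 H1] := lls _ _ _ su c0; have [n2 H2] := eps0 _ c0.
  exists (maxn n1 n2) => //; exists u; first by rewrite /u; apply/andP; split; lra.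
  have := Hr u; rewrite /u addrAC subrr add0r gtr0_norm// -/u => /(_ ltac:(lra)).
  rewrite ltr_norml => /andP[_ zu].
  have := lsm _ _ u (leq_maxl n1 n2); have := epsm _ _ (leq_maxr n1 n2).
  by rewrite /particle in zs zu H1 H2 c0 *; lra.
exists n; apply: le_lt_trans Hn; rewrite lerD2r.
have th2 : 0 < t + h / 2 by lra.
have mD : measurable (hits Z l 0 (t + h / 2) `\` hits_lt Z l 0 (t + h / 2)).
  by apply: measurableD => //; exact: measurable_hits_particle.
have <- : pr (hits_lt Z l 0 (t + h / 2)) +
    pr (hits Z l 0 (t + h / 2) `\` hits_lt Z l 0 (t + h / 2)) =
    pr (hits_lt Z l 0 (t + h / 2)) by rewrite touching_null// addr0.
apply: pr_cover => //; first exact: measurable_hits_particle.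
move=> w [s /andP[s0 st] zs].
have [?|?] := pselect (hits_lt Z l 0 (t + h / 2) w); [by left|right; split => //].
by exists s => //; apply/andP; split; lra.
Qed.

(* If the boundary moves by [delta] between [t] and [u], the density hypothesis
   makes the loss at least [E (min (max (delta - W) 0) y1)], where [W] is the
   increment of [B]; as [W] is symmetric, this exceeds [delta]. *)
Lemma instantaneous_loss (l : R -> R) (alpha t y0 : R) : rcnd l ->
  0 < alpha -> 0 <= t -> 0 < y0 ->
  (forall y, 0 < y < y0 ->
    y <= alpha * pr (~` hits Z l 0 t `&` [set w | Z t w <= l t + y])) ->
  ~ (forall s, t <= s -> l s = alpha * pr (hits Z l 0 s)).
Proof.
move=> rl alpha0 t0 y00 dens sol.
(* A rise below y0 / 4 gives 2 * delta < y1 for the cap y1 = y0 / 2, as the symmetric sum requires,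
   while y1 < y0 stays in the range of the density hypothesis. *)
have [h h0 lh] := rl.2 t (y0 / 4) ltac:(lra).
pose u := t + h; have tu : t < u by rewrite /u; lra.
have u0 : 0 <= u by lra.
pose delta := l u - l t; pose y1 := y0 / 2.
have delta0 : 0 <= delta by rewrite subr_ge0; apply: homo_leW (ltW tu); exact: rl.1.
have deltay : 2 * delta < y1 by rewrite /delta /y1 /u; lra.
pose N := ~` hits Z l 0 t.
have mH := fun s => measurable_hits_particle 0 s rl.
have mN : measurable N by exact: measurableC.
pose Y w := Z t w - l t; pose W := increment B t u.
have mY : measurable_fun setT Y by apply: measurable_funB => //; exact: measurable_particle.
have mW : measurable_fun setT W by exact: measurable_increment.
have mYle (c : R) : measurable (Y @^-1` `]-oo, c]).
  by apply: measurable_preimage.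
have loss : alpha * pr (N `&` [set w | W w + Y w <= delta]) <= delta.
  have mE : measurable (N `&` [set w | W w + Y w <= delta]).
    apply: measurableI => //.
    rewrite (_ : [set w | _] = (W \+ Y) @^-1` `]-oo, delta]%classic).
      by apply: measurable_preimage => //; exact: measurable_funD.
    by apply/seteqP; split=> w; rewrite /= in_itv.
  have : pr (N `&` [set w | W w + Y w <= delta]) + pr (hits Z l 0 t) <= pr (hits Z l 0 u).
    rewrite -pr_disjU//; last by apply/seteqP; split => // w [] [].
    apply: pr_le => //; first exact: measurableU.
    move=> w [[_ /= Hw]|[s /andP[s0 st] zs]]; last first.
      by exists s => //; rewrite s0/=; lra.
    exists u; first by rewrite u0 lexx.
    by rewrite (particle_increment w t0 u0); rewrite /W /Y /delta in Hw; lra.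
  by rewrite /delta (sol u) ?(sol t)//; [nra|exact: ltW].
pose Q := restricted_law P measurableT mW.
have QE (A : set R) : Q A = P (W @^-1` A) by rewrite /Q /restricted_law setIT.
have s0 := sqrt_sub_neq0 tu.
have QN (A : set R) : measurable A -> Q ((-%R : R -> R) @^-1` A) = Q A.
  move=> mA; have mNA : measurable ((-%R : R -> R) @^-1` A).
    by apply: measurable_preimage => //; exact: oppr_measurable.
  by rewrite !QE !(increment_law bB t0 tu)// normal_probN.
pose f (x : R) := Num.min (Num.max (delta - x) 0) y1.
have f0 x : 0 <= f x by rewrite le_min le_max lexx orbT/=; rewrite /y1; lra.
have mf : measurable_fun setT f.
  apply: measurable_minr => //; apply: measurable_maxr => //.
  by apply: measurable_funB.
have mfN : measurable_fun setT (fun x : R => f (- x)).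
  by apply: measurableT_comp => //; exact: oppr_measurable.
have outN : <<s outside_events X0 B t u setT >> N.
  apply: (@measurableC _ (outside t u)); apply: (@measurable_hits R _ (outside t u)) => //.
    by move=> w; exact: (particle_continuous bB).
  move=> s /andP[s00 st]; apply: measurable_funD; first exact: outside_measurable_initial.
  by rewrite (max_idPl s00); apply: outside_measurable_past; rewrite s00.
have mYo : measurable_fun setT (Y : outside t u -> R).
  apply: measurable_funB => //; apply: measurable_funD; first exact: outside_measurable_initial.
  by rewrite (max_idPl t0); apply: outside_measurable_past; rewrite t0 lexx.
have mS : measurable [set p : R * R | p.1 + p.2 <= delta].
  rewrite (_ : [set p | _] = (fun p => p.1 + p.2) @^-1` `]-oo, delta]%classic).
    apply: measurable_preimage => //.
    by apply: measurable_funD; [exact: measurable_fst|exact: measurable_snd].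
  by apply/seteqP; split=> p; rewrite /= in_itv.
have ind (C D : set R) : measurable C -> measurable D ->
    P (N `&` (Y @^-1` D) `&` W @^-1` C) = (P (N `&` Y @^-1` D) * Q C)%E.
  move=> mC mD; rewrite QE; apply: (outside_events_independent bB mX0 iX0) => //.
    exact: ltW.
  apply: (@measurableI _ (outside t u)) => //.
  by have := mYo measurableT D mD; rewrite setTI.
have fub := independent_fubini mN mW mY ind mS.
pose I := (\int[Q]_x (f x)%:E)%E.
have I_le : (I <= delta%:E)%E.
  apply: le_trans (_ : (alpha * pr (N `&` [set w | W w + Y w <= delta]))%:E <= _)%E; last first.
    by rewrite lee_fin.
  rewrite EFinM -prE; last first.
    apply: measurableI => //.
    rewrite (_ : [set w | _] = (W \+ Y) @^-1` `]-oo, delta]%classic).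
      by apply: measurable_preimage => //; exact: measurable_funD.
    by apply/seteqP; split=> w; rewrite /= in_itv.
  rewrite [X in P (N `&` X)](_ : _ = [set w | [set p : R * R | p.1 + p.2 <= delta] (W w, Y w)])//.
  rewrite fub.
  have mg : measurable_fun setT (fun x : R => P (N `&` [set w | x + Y w <= delta])).
    have := @measurable_fun_xsection _ _ _ _ R (restricted_law P mN mY) _ mS.
    rewrite (_ : (_ \o _) = (fun x : R => P (N `&` [set w | x + Y w <= delta])))//.
    apply/funext => x /=; rewrite /restricted_law setIC; congr (P (_ `&` _)).
    by apply/seteqP; split=> w; rewrite /xsection /= in_setE.
  rewrite -ge0_integralZl//; last by rewrite lee_fin ltW.
  apply: ge0_le_integral => //.
  - by move=> x _; rewrite lee_fin.
  - exact/measurable_EFinP.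
  - exact: measurable_funeM.
  move=> x _ /=.
  have NYE : N `&` [set w | x + Y w <= delta] = N `&` Y @^-1` `]-oo, delta - x].
    by apply/seteqP; split=> w [Nw]; rewrite /= in_itv/= => ?; split => //=; lra.
  have mNY : measurable (N `&` [set w | x + Y w <= delta]) by rewrite NYE; exact: measurableI.
  rewrite (prE _ mNY) -EFinM lee_fin.
  have [dx|dx] := leP (delta - x) 0.
    rewrite /f (max_idPr dx) (min_idPl _); last by rewrite /y1; lra.
    by apply: mulr_ge0; [exact: ltW|exact: pr_ge0].
  (* Given the increment x, all particles alive at t within delta - x of the boundary are lost by
     time u; the density hypothesis is applied at this distance, capped by y1. *)
  rewrite /f (max_idPl (ltW dx)); set y := Num.min _ _.
  have y_gt0 : 0 < y by rewrite lt_min dx /y1; lra.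
  have y_le : y <= delta - x by rewrite ge_min lexx.
  have y_le' : y <= y1 by rewrite ge_min lexx orbT.
  apply: le_trans (dens y _) _; first by rewrite y_gt0/=; move: y_le'; rewrite /y1; lra.
  rewrite ler_pM2l//; apply: pr_le => //.
    have := measurableI _ _ mN (mYle y); congr measurable.
    by apply/seteqP; split=> w [Nw]; rewrite /= in_itv/= /Y => ?; split => //=; lra.
  by move=> w [Nw /= ?]; split => //=; rewrite /Y; lra.
have I_sym : (\int[Q]_x (f (- x))%:E = I)%E.
  rewrite /I; transitivity (\int[pushforward Q (-%R : R -> R)]_x (f x)%:E)%E.
    have mO : measurable_fun setT (-%R : R -> R) by exact: oppr_measurable.
    rewrite ge0_integral_pushforward//; first exact/measurable_EFinP.
    by move=> x _; rewrite lee_fin.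
  by apply: eq_measure_integral => A mA _; exact: QN.
have gt : ((2 * delta)%:E < I + I)%E.
  rewrite -{2}I_sym -ge0_integralD//; last 4 first.
  - by move=> x _; rewrite lee_fin.
  - exact/measurable_EFinP.
  - by move=> x _; rewrite lee_fin.
  - exact/measurable_EFinP.
  (* The strict gain: increments of size at least y1 have positive probability and contribute y1
     instead of 2 * delta to the symmetrized integrand. *)
  pose k := (y1 - 2 * delta) * pr (W @^-1` `[y1, +oo[).
  apply: (@lt_le_trans _ _ (2 * delta + k)%:E).
    rewrite lte_fin ltrDl mulr_gt0//; first lra.
    rewrite -lte_fin -prE; last by apply: measurable_preimage.
    by rewrite (increment_law bB t0 tu)// normal_prob_tail_gt0.
  have -> : (2 * delta + k)%:E =
    (\int[Q]_x ((2 * delta)%:E + (y1 - 2 * delta)%:E * (\1_(`[y1, +oo[) x)%:E))%E.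
    rewrite ge0_integralD//; last 3 first.
    - by move=> x _; rewrite lee_fin; lra.
    - by move=> x _; rewrite mule_ge0// lee_fin//; lra.
    - by apply: measurable_funeM; apply/measurable_EFinP; exact: measurable_indic.
    have -> : (\int[Q]_x (2 * delta)%:E = (2 * delta)%:E)%E.
      transitivity ((2 * delta)%:E * Q setT)%E; first exact: integral_cst.
      by rewrite QE preimage_setT probability_setT mule1.
    rewrite ge0_integralZl//; last 2 first.
    - by apply/measurable_EFinP; exact: measurable_indic.
    - by rewrite lee_fin; lra.
    have -> : (\int[Q]_x (\1_(`[y1, +oo[) x)%:E = (pr (W @^-1` `[y1, +oo[))%:E)%E.
      transitivity (Q (`[y1, +oo[ `&` setT)); first exact: integral_indic.
      by rewrite setIT QE prE//; exact: measurable_preimage.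
    by rewrite -EFinM -EFinD.
  apply: ge0_le_integral => //.
  - by move=> x _; rewrite adde_ge0// ?mule_ge0// lee_fin//; lra.
  - apply: emeasurable_funD => //; apply: measurable_funeM.
    by apply/measurable_EFinP; exact: measurable_indic.
  - by apply: emeasurable_funD; exact/measurable_EFinP.
  move=> x _; rewrite -EFinM -!EFinD lee_fin indicE.
  have [f1 f2] := clipped_symmetric_sum x delta0 deltay.
  case: (boolP (x \in _)) => [|_]; last by rewrite mulr0 addr0.
  rewrite inE/= in_itv/= andbT mulr1 addrC subrK; exact: f2.
have : ((2 * delta)%:E < (2 * delta)%:E)%E.
  apply: lt_le_trans gt _; rewrite (_ : 2 * delta = delta + delta); last by lra.
  by rewrite EFinD leeD.
by rewrite ltxx.
Qed.

End crossing.

(** * The minimal solution *)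

Section regularization.
Context {R : realType}.
Implicit Types (f g G : R -> R).

(** The right-continuous version of a nondecreasing G. It is needed because an increasing limit of
    right-continuous functions may fail to be right-continuous. *)
Definition right_reg G (t : R) : R := inf [set G s | s in `]t, +oo[].

Lemma right_reg_has_inf G t : {homo G : s u / s <= u} ->
  has_inf [set G s | s in `]t, +oo[].
Proof.
move=> mG; split; first by exists (G (t + 1)), (t + 1) => //=; rewrite in_itv/= andbT ltrDl.
exists (G t) => _ [s /= + <-]; rewrite in_itv/= andbT => ts.
exact/mG/ltW.
Qed.

Lemma right_reg_ge G t c : {homo G : s u / s <= u} ->
  (forall s, t < s -> c <= G s) -> c <= right_reg G t.
Proof.
move=> mG H; apply: lb_le_inf; first exact: (right_reg_has_inf t mG).1.
by move=> _ [s /= + <-]; rewrite in_itv/= andbT; exact: H.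
Qed.

Lemma right_reg_le G s t : {homo G : s u / s <= u} -> t < s -> right_reg G t <= G s.
Proof.
move=> mG ts; apply: ge_inf; first exact: (right_reg_has_inf t mG).2.
by exists s => //=; rewrite in_itv/= andbT.
Qed.

Lemma right_reg_rcnd G : {homo G : s u / s <= u} -> rcnd (right_reg G).
Proof.
move=> mG; split=> [s t st|t e e0].
  apply: right_reg_ge => // u tu; apply: right_reg_le => //.
  exact: le_lt_trans tu.
have [_ [s /= + <-] Hs] := inf_adherent e0 (right_reg_has_inf t mG).
rewrite in_itv/= andbT => ts; exists ((s - t) / 2); first lra.
by apply: le_lt_trans Hs; apply: right_reg_le => //; lra.
Qed.

Lemma right_reg_Mspace G : {homo G : s u / s <= u} ->
  (forall t, t < 0 -> G t = 0) -> Mspace (right_reg G).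
Proof.
move=> mG G0; apply/MspaceP; split; first exact: right_reg_rcnd.
move=> t t0; apply/eqP; rewrite eq_le; apply/andP; split.
  by rewrite -(G0 (t / 2)); [apply: right_reg_le => //; lra|lra].
by rewrite -(G0 t t0); apply: right_reg_ge => // s /ltW; exact: mG.
Qed.

Definition sup_seq (f : nat -> R -> R) (t : R) : R := sup [set f n t | n in setT].

Section sup_seq.
Variables (f : nat -> R -> R) (c : R).
Hypotheses (Mf : forall n, Mspace (f n)) (fc : forall n t, f n t <= c).

Let f_has_sup t : has_sup [set f n t | n in setT].
Proof. by split; [exists (f 0%N t), 0%N|exists c => _ [n _ <-]]. Qed.

Lemma sup_seq_ge n t : f n t <= sup_seq f t.
Proof. by apply: sup_ubound; [exact: (f_has_sup t).2|exists n]. Qed.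

Lemma sup_seq_le t b : (forall n, f n t <= b) -> sup_seq f t <= b.
Proof. by move=> H; apply: sup_le_ub; [exact: (f_has_sup t).1|move=> _ [n _ <-]]. Qed.

Lemma sup_seq_homo : {homo sup_seq f : s t / s <= t}.
Proof.
move=> s t st; apply: sup_seq_le => n; apply: le_trans (sup_seq_ge n t).
exact: (Mspace_homo (Mf n)).
Qed.

Lemma sup_seq_lt0 t : t < 0 -> sup_seq f t = 0.
Proof.
move=> t0; apply/eqP; rewrite eq_le -{2}(Mspace_lt0 (Mf 0) t0) sup_seq_ge andbT.
by apply: sup_seq_le => n; rewrite (Mspace_lt0 (Mf n) t0).
Qed.

Lemma sup_seq_approx t e : 0 < e -> exists n, sup_seq f t - e <= f n t.
Proof.
move=> e0; have [_ [n _ <-] Hn] := sup_adherent e0 (f_has_sup t).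
by exists n; exact: ltW.
Qed.

End sup_seq.

(** Used to splice boundaries; the comparison with [g a] makes the passage at a an upward jump. *)
Lemma rcnd_glue f g (a : R) : rcnd f -> rcnd g ->
  (forall s, s < a -> f s <= g a) -> rcnd (fun s => if s < a then f s else g s).
Proof.
move=> [mf rf] [mg rg] fg; split=> [s t st|t e e0].
  case: ltP => sa; case: ltP => ta; [exact: mf| |lra|exact: mg].
  by apply: le_trans (fg s sa) _; exact: mg.
case: ltP => ta; last first.
  have [r r0 Hr] := rg t e e0; exists r => //.
  by rewrite ifF//; apply/negbTE; rewrite -leNgt; lra.
have [r r0 Hr] := rf t e e0.
exists (Num.min r ((a - t) / 2)); first by rewrite lt_min r0/=; lra.
have m1 : Num.min r ((a - t) / 2) <= r by rewrite ge_min lexx.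
have m2 : Num.min r ((a - t) / 2) <= (a - t) / 2 by rewrite ge_min lexx orbT.
have -> : t + Num.min r ((a - t) / 2) < a by lra.
by apply: le_lt_trans Hr; apply: mf; lra.
Qed.

End regularization.

(** * The operator Gamma and its least supersolution *)

Section gamma.
Context {R : realType} d (T : measurableType d) (P : probability T R).
Variables (alpha : R) (B : R -> {RV P >-> R}).
Hypotheses (alpha0 : 0 < alpha) (bB : brownian_motion B).
Implicit Types (X : T -> R) (l : R -> R).

Local Notation pr := (pr P).
Local Notation Gam X l t := (Gamma P alpha B X l t).

Definition admissible X := measurable_fun setT X /\ independent_of_process P X B.

Lemma admissible_shift X c : admissible X -> admissible (fun w => X w + c).
Proof.
move=> [mX iX]; split; first exact: measurable_funD.
move=> A E mA sE; have mA' : measurable ((fun x : R => x + c) @^-1` A).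
  by apply: measurable_preimage => //; exact: measurable_funD.
exact: (iX _ _ mA' sE).
Qed.

Lemma hits_measurable X l a b : measurable_fun setT X -> rcnd l ->
  measurable (hits (particle X B) l a b).
Proof. by move=> mX rl; exact: measurable_hits_particle. Qed.

Lemma GammaE X l t : rcnd l -> Gam X l t = alpha * pr (hits (particle X B) l 0 t).
Proof.
move=> rl; congr (_ * fine (P _)); apply/seteqP; split=> w /=.
  by move/hitting_time_leP; apply => //; exact: (particle_continuous bB).
by move/hitting_time_leP; apply => //; exact: (particle_continuous bB).
Qed.

Lemma Gamma_ge0 X l t : rcnd l -> 0 <= Gam X l t.
Proof. by move=> rl; rewrite GammaE// mulr_ge0 ?pr_ge0// ltW. Qed.

Lemma Gamma_le_alpha X l t : measurable_fun setT X -> rcnd l -> Gam X l t <= alpha.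
Proof.
move=> mX rl; rewrite GammaE// ger_pMr//; apply: pr_le1.
exact: hits_measurable.
Qed.

Lemma Gamma_le X X' l l' t : measurable_fun setT X -> measurable_fun setT X' ->
  rcnd l -> rcnd l' ->
  (forall s w, 0 <= s <= t -> X' w - l' s <= X w - l s) ->
  Gam X l t <= Gam X' l' t.
Proof.
move=> mX mX' rl rl' H; rewrite !GammaE// ler_pM2l//.
apply: pr_le; [exact: hits_measurable|exact: hits_measurable|].
move=> w [s st zs]; exists s => //.
by have := H s w st; move: zs; rewrite /particle; lra.
Qed.

(** Right continuity is continuity of P from above: a first hit that comes before t + 1 / (n + 1)
    for every n comes by t. *)
Lemma Gamma_Mspace X l : measurable_fun setT X -> rcnd l -> Mspace (Gamma P alpha B X l).
Proof.
move=> mX rl; apply/MspaceP; split; last first.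
  move=> t t0; rewrite GammaE// (_ : hits _ _ _ _ = set0).
    by rewrite pr_set0 mulr0.
  by apply/seteqP; split=> // w [s /andP[? ?] _]; exfalso; lra.
split=> [s t st|t e e0]; rewrite !GammaE//.
  rewrite ler_pM2l//; apply: pr_le; [exact: hits_measurable|exact: hits_measurable|].
  by move=> w [u /andP[u0 us] zu]; exists u => //; rewrite u0 (le_trans us).
have e0' : 0 < e / alpha by rewrite divr_gt0.
have mF n : measurable (hits (particle X B) l 0 (t + n.+1%:R^-1)).
  exact: hits_measurable.
have [||n] := pr_dec P e0' (hits_measurable 0 t mX rl) mF.
- move=> m n mn w [s /andP[s0 st] zs]; exists s => //.
  by rewrite s0 (le_trans st)// lerD2l invSn_le.
- move=> w H; have [s [/andP[s0 _] zs] smin] := first_hit (@particle_continuous _ _ _ P B bB X w) rl (H 0%N I).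
  exists s => //; rewrite s0/=; apply/ler_addgt0Pr => c c0.
  have [n Hn] := invSn_small c0; have [u /andP[u0 un] zu] := H n I.
  apply: (@le_trans _ _ u).
    apply: smin => //; rewrite u0 (le_trans un)// lerD2l.
    exact: (@invSn_le R 0 n).
  by apply: le_trans un _; rewrite lerD2l ltW.
move=> Hn; exists n.+1%:R^-1; first exact: invSn_gt0.
by rewrite GammaE// -ltr_pdivlMl// mulrDr mulKf ?gt_eqF// mulrC.
Qed.

Definition supersolution X l := Mspace l /\ forall t, 0 <= t -> Gam X l t <= l t.

Lemma solutionE X l t : measurable_fun setT X -> solution P alpha B X l ->
  l t = Gam X l t.
Proof.
move=> mX [Ml Hl]; have [t0|t0] := leP 0 t; first exact: Hl.
by rewrite (Mspace_lt0 Ml t0) (Mspace_lt0 (Gamma_Mspace mX (Mspace_rcnd Ml)) t0).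
Qed.

Lemma solution_supersolution X l : solution P alpha B X l -> supersolution X l.
Proof. by move=> [Ml Hl]; split => // t t0; rewrite -Hl. Qed.

(** Lower semicontinuity of hitting probabilities costs a delay u - t, which the right
    regularization absorbs. It serves the Picard iterates, with eps = 0, and the minimal solutions
    for X + 1 / (n + 1). *)
Lemma increasing_limit_supersolution X (ls : nat -> R -> R) (eps : nat -> R) G :
  admissible X -> (forall n, Mspace (ls n)) ->
  (forall m n s, (m <= n)%N -> ls m s <= ls n s) ->
  (forall m n, (m <= n)%N -> eps n <= eps m) ->
  (forall c, 0 < c -> exists n, eps n <= c) ->
  (forall s c, 0 < c -> exists n, G s - c <= ls n s) ->
  {homo G : s t / s <= t} -> (forall s, s < 0 -> G s = 0) ->
  (forall n t, 0 <= t -> Gam (fun w => X w + eps n) (ls n) t <= G t) ->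
  supersolution X (right_reg G).
Proof.
move=> [mX iX] Mls lsm epsm eps0 lsG mG G0 H.
have rL := right_reg_rcnd mG.
split; first exact: right_reg_Mspace.
move=> t t0; apply: right_reg_ge => // u tu; apply/ler_addgt0Pl => e e0.
have e0' : 0 < e / alpha by rewrite divr_gt0.
have ut : 0 < u - t by lra.
have [|n] := hits_lower_semicontinuous bB mX iX rL (fun n => Mspace_rcnd (Mls n))
  lsm epsm eps0 _ t0 ut e0'.
  move=> s v c sv /(lsG v)[n Hn]; exists n.
  by have := right_reg_le mG sv; lra.
rewrite (_ : t + (u - t) = u); last lra.
move=> Hn; have u0 : 0 <= u by lra.
have := H n u u0; rewrite !GammaE//; last exact: Mspace_rcnd.
move: Hn; rewrite -(ltr_pM2l alpha0) mulrBr (mulrC _ (e / alpha)) divfK ?gt_eqF//.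
lra.
Qed.

Section picard.
Variable X : T -> R.
Hypothesis aX : admissible X.

Definition picard n := iter n (Gamma P alpha B X) (cst 0).

Let mX := aX.1.

Lemma picard_Mspace n : Mspace (picard n).
Proof.
elim: n => [|n IH]; first exact: Mspace_cst0.
exact/Gamma_Mspace/Mspace_rcnd.
Qed.

Let rpic n := Mspace_rcnd (picard_Mspace n).

Lemma picard_le_alpha n t : picard n t <= alpha.
Proof. case: n => [|n]; [exact: ltW|exact: Gamma_le_alpha]. Qed.

Lemma picard_mono m n t : (m <= n)%N -> picard m t <= picard n t.
Proof.
move=> /subnK <-; elim: (n - m)%N => {n}// n IH; apply: le_trans IH _.
rewrite addSn; move: (n + m)%N => {m}{}n; elim: n t => [|n IH] t.
  exact: (Mspace_ge0 _ (picard_Mspace 1)).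
by apply: (Gamma_le mX mX (rpic n) (rpic n.+1)) => s w _; rewrite lerB.
Qed.

Lemma picard_le_supersolution l n t : supersolution X l -> picard n t <= l t.
Proof.
move=> [Ml Hl]; elim: n t => [|n IH] t; first exact: Mspace_ge0.
have [t0|t0] := leP 0 t; last by rewrite (Mspace_lt0 Ml t0) (Mspace_lt0 (picard_Mspace n.+1) t0).
apply: le_trans (Hl t t0).
by apply: (Gamma_le mX mX (rpic n) (Mspace_rcnd Ml)) => s w _; rewrite lerB.
Qed.

Let G := sup_seq picard.
Let picard_le_G n t : picard n t <= G t.
Proof. exact: sup_seq_ge picard_le_alpha n t. Qed.
Let G_le t c : (forall n, picard n t <= c) -> G t <= c.
Proof. exact: sup_seq_le picard_le_alpha t c. Qed.
Let mG : {homo G : s t / s <= t}.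
Proof. exact: sup_seq_homo picard_Mspace picard_le_alpha. Qed.
Let G_lt0 t : t < 0 -> G t = 0.
Proof. exact: sup_seq_lt0 picard_Mspace picard_le_alpha t. Qed.
Let G_approx t c : 0 < c -> exists n, G t - c <= picard n t.
Proof. exact: sup_seq_approx picard_le_alpha t c. Qed.

Definition picard_limit := right_reg G.

Lemma picard_limit_Mspace : Mspace picard_limit.
Proof. exact: right_reg_Mspace. Qed.

Lemma picard_wcvg : wcvg picard picard_limit.
Proof.
move=> t e e0; have [N HN] := G_approx t e0; exists N => n Nn; apply/andP; split.
  have : picard_limit (t - e) <= G t by apply: right_reg_le => //; lra.
  by have := picard_mono t Nn; lra.
have : picard n t <= picard_limit (t + e).
  apply: right_reg_ge => // s st; apply: le_trans (picard_le_G n s).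
  by apply: homo_leW (rpic n).1 _; lra.
lra.
Qed.

Lemma picard_limit_supersolution : supersolution X picard_limit.
Proof.
apply: (increasing_limit_supersolution (ls := picard) (eps := fun=> 0)) => //.
- exact: picard_Mspace.
- by move=> m n s; exact: picard_mono.
- by move=> c c0; exists 0%N; exact: ltW.
- move=> n t t0; rewrite (_ : (fun w => X w + 0) = X).
    exact: (picard_le_G n.+1).
  by apply/funext => w; rewrite addr0.
Qed.

Lemma picard_limit_solution : solution P alpha B X picard_limit.
Proof.
have ML := picard_limit_Mspace; split => // t t0; apply/eqP; rewrite eq_le.
apply/andP; split; last exact: picard_limit_supersolution.2.
apply: rcnd_le_of_gt; first exact/Mspace_rcnd/Gamma_Mspace/Mspace_rcnd.
move=> s ts; apply: le_trans (right_reg_le mG ts) _; apply: G_le => -[|n].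
  by apply: Gamma_ge0; exact: Mspace_rcnd.
apply: (Gamma_le mX mX (rpic n) (Mspace_rcnd ML)) => u w _; rewrite lerB//.
apply: right_reg_ge => // v uv; apply: le_trans (picard_le_G n v).
exact: homo_leW (rpic n).1 (ltW uv).
Qed.

(** The choice operator is determined because the weak limit of the iterates is an M1 limit and M1
    limits in [Dspace] are unique. *)
Lemma minimal_solutionE : minimal_solution P alpha B X = picard_limit.
Proof.
rewrite /minimal_solution; apply: xget_unique.
  split; first by have [] := picard_limit_Mspace.
  apply: wcvg_M1_cvg; [exact: picard_Mspace|exact: picard_limit_Mspace|exact: picard_wcvg].
move=> g [Dg cg]; apply: (M1_cvg_unique picard_Mspace picard_limit_Mspace picard_wcvg) => //.
Qed.

Lemma minimal_solution_solution : solution P alpha B X (minimal_solution P alpha B X).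
Proof. by rewrite minimal_solutionE; exact: picard_limit_solution. Qed.

Lemma minimal_solution_le l t : supersolution X l ->
  minimal_solution P alpha B X t <= l t.
Proof.
move=> sl; rewrite minimal_solutionE; apply: rcnd_le_of_gt; first exact/Mspace_rcnd/sl.1.
move=> s ts; apply: le_trans (right_reg_le mG ts) _; apply: G_le => n.
exact: picard_le_supersolution.
Qed.

End picard.

End gamma.

(** * Jumps and comparison *)

Section jumps.
Context {R : realType} d (T : measurableType d) (P : probability T R).
Variables (alpha : R) (B : R -> {RV P >-> R}).
Hypotheses (alpha0 : 0 < alpha) (bB : brownian_motion B).
Implicit Types (X : T -> R) (l L : R -> R).

Local Notation pr := (pr P).
Local Notation Gam X l t := (Gamma P alpha B X l t).
Local Notation Z X := (particle X B).

(* The particles that are alive just before time [t] and would be absorbed at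
   time [t] by a jump of size [x]. *)
Definition exposed X L t x : set T :=
  ~` hits_before (Z X) L t `&` [set w | Z X t w <= leftlim L t + x].

Definition physical_jump X L t : R :=
  inf [set x | 0 < x /\ alpha * pr (exposed X L t x) < x].

Lemma particle_le_measurable X t c : measurable_fun setT X ->
  measurable [set w | Z X t w <= c].
Proof.
move=> mX; rewrite (_ : [set w | _] = Z X t @^-1` `]-oo, c]%classic).
  by apply: measurable_preimage => //; exact: measurable_particle.
by apply/seteqP; split=> w; rewrite /= in_itv.
Qed.

Lemma hits_before_measurable X L t : measurable_fun setT X -> rcnd L ->
  measurable (hits_before (Z X) L t).
Proof.
move=> mX rL; apply: measurable_hits_before => //.
  exact: particle_continuous.
by move=> s _; exact: measurable_particle.
Qed.

Lemma exposed_measurable X L t x : measurable_fun setT X -> rcnd L ->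
  measurable (exposed X L t x).
Proof.
move=> mX rL; apply: measurableI; last exact: particle_le_measurable.
by apply: measurableC; exact: hits_before_measurable.
Qed.

Lemma leftlim_state X L t w : rcnd L ->
  leftlim (fun s => state X B L s w) t = Z X t w - leftlim L t.
Proof.
move=> rL; apply/cvg_lim => //; apply: cvgB.
  by apply: cvg_at_left_filter; exact: (@particle_continuous _ _ _ P B bB X w).
exact: nondecreasing_cvg_left rL.1.
Qed.

(** For t > 0 the events differ only by particles exactly at the left limit, a null set, since a
    particle strictly below it would have been hit earlier. For t = 0 the clause on X <= 0 supplies
    the remaining particles. *)
Lemma exposed_event X L t x : admissible B X -> Mspace L -> 0 <= t -> 0 < x ->
  fine (P [set w | (t%:E <= hitting_time X B L w)%E /\
    (0 < leftlim (fun s => state X B L s w) t <= x \/ t = 0 /\ X w <= 0)]) =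
  pr (exposed X L t x).
Proof.
move=> [mX iX] ML t0 x0; have rL := Mspace_rcnd ML.
have L0 : leftlim L 0 = 0 by have [] := ML.
set J := [set w | _].
have JE : J = ~` hits_before (Z X) L t `&`
    [set w | 0 < Z X t w - leftlim L t <= x \/ t = 0 /\ X w <= 0].
  by apply/seteqP; split=> w; rewrite /J /= leftlim_state// => -[/hitting_time_geP].
have mJ : measurable J.
  rewrite JE; apply: measurableI.
    by apply: measurableC; exact: hits_before_measurable.
  rewrite (_ : [set w | _] = ((Z X t @^-1` `]leftlim L t, leftlim L t + x]) `|`
      [set w | t = 0 /\ X w <= 0])).
    apply: measurableU.
      by apply: measurable_preimage => //; exact: measurable_particle.
    have [->|/eqP tn0] := eqVneq t 0.
      rewrite (_ : [set w | _] = X @^-1` `]-oo, 0]%classic).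
        exact: measurable_preimage.
      by apply/seteqP; split=> [w [_ /=]|w /=]; rewrite in_itv.
    by rewrite (_ : [set w | _] = set0)// -subset0 => w [].
  apply/seteqP; split=> w /=; rewrite in_itv/=.
    by move=> [/andP[? ?]|]; [left; apply/andP; split; lra|right].
  by move=> [/andP[? ?]|]; [left; apply/andP; split; lra|right].
have mE := exposed_measurable t x mX rL.
rewrite -/(pr J); apply/eqP; rewrite eq_le; apply/andP; split.
  apply: pr_le => //; rewrite JE => w [Hw /= H]; split => //=.
  case: H => [/andP[]|[t00 Xw]]; first lra.
  by rewrite t00 L0 (particle0 bB); lra.
have [t00|/eqP tn0] := eqVneq t 0.
  apply: pr_le => //; rewrite JE => w [Hw /= H]; split => //=.
  move: H; rewrite t00 L0 (particle0 bB) => H.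
  have [?|?] := leP (X w) 0; first by right.
  by left; apply/andP; split; lra.
have tp : 0 < t by rewrite lt_def t0 andbT; apply/eqP.
rewrite -[leRHS]addr0 -(particle_no_atom bB mX iX (leftlim L t) tp).
apply: pr_cover => //.
  rewrite (_ : [set w | _] = Z X t @^-1` [set (leftlim L t)]); last by [].
  by apply: measurable_preimage => //; exact: measurable_particle.
move=> w [Hw /= Zx]; rewrite JE.
have [ZL|ZL|ZL] := ltgtP (Z X t w) (leftlim L t); last by right.
  exfalso; have e0 : 0 < (leftlim L t - Z X t w) / 2 by lra.
  have [r r0 Hr] := continuous_eps t (@particle_continuous _ _ _ P B bB X w) e0.
  have [s st Hs] := leftlim_approx t rL.1 e0.
  (* Before t, yet close enough for the path to have moved little and late enough for L to be near
     its left limit. *)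
  pose u := Num.max (Num.max s 0) (t - r / 2).
  have ut : u < t by rewrite !gt_max st tp/=; lra.
  have su : s <= u by rewrite !le_max lexx.
  have u0 : 0 <= u by rewrite !le_max lexx orbT.
  have ru : t - r / 2 <= u by rewrite le_max lexx orbT.
  apply: Hw; exists u; first by rewrite u0.
  have := Hr u; rewrite ltr0_norm; last lra.
  move=> /(_ ltac:(lra)); rewrite ltr_norml => /andP[_ h].
  have := homo_leW rL.1 su; lra.
by left; split => //=; left; apply/andP; split; lra.
Qed.

Lemma physical_solutionP X L : admissible B X ->
  physical_solution P alpha B X L <-> solution P alpha B X L /\
    forall t, 0 <= t -> L t - leftlim L t = physical_jump X L t.
Proof.
move=> aX; split=> -[[ML HL] H]; split => // t t0; rewrite ?H// ?H//;
  congr inf; apply/seteqP; split=> x /= [x0].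
- by rewrite exposed_event.
- by rewrite exposed_event.
- by rewrite exposed_event.
- by rewrite exposed_event.
Qed.

Lemma physical_jump_has_inf X L t : admissible B X -> rcnd L ->
  has_inf [set x | 0 < x /\ alpha * pr (exposed X L t x) < x].
Proof.
move=> [mX _] rL; split; last by exists 0 => x [/ltW].
exists (alpha + 1); split; first exact: addr_gt0.
apply: (@le_lt_trans _ _ alpha); last by rewrite ltrDl.
by rewrite ger_pMr//; apply: pr_le1; exact: exposed_measurable.
Qed.

Lemma below_physical_jump X L t x : admissible B X -> rcnd L -> 0 < x ->
  x < physical_jump X L t -> x <= alpha * pr (exposed X L t x).
Proof.
move=> aX rL x0 xD; rewrite leNgt; apply/negP => H; move: xD; apply/negP.
by rewrite -leNgt; apply: ge_inf; [exact: (physical_jump_has_inf t aX rL).2|].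
Qed.

Lemma above_physical_jump X L t c : admissible B X -> rcnd L ->
  physical_jump X L t < c ->
  exists x, [/\ 0 < x, x < c & alpha * pr (exposed X L t x) < x].
Proof.
move=> aX rL Dc; have e0 : 0 < c - physical_jump X L t by lra.
have [x [x0 xS] xc] := inf_adherent e0 (physical_jump_has_inf t aX rL).
by exists x; split => //; rewrite /physical_jump in xc *; lra.
Qed.

Lemma hits_before_ge X L t : admissible B X -> solution P alpha B X L ->
  leftlim L t <= alpha * pr (hits_before (Z X) L t).
Proof.
move=> [mX _] sL; have rL := Mspace_rcnd sL.1.
apply: leftlim_le; first exact: rL.1.
move=> s st; rewrite (solutionE alpha0 bB _ mX sL) GammaE// ler_pM2l//.
apply: pr_le; [exact: hits_measurable|exact: hits_before_measurable|].
by move=> w [u /andP[u0 us] zu]; exists u => //; rewrite u0 (le_lt_trans us).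
Qed.

Lemma hits_before_le X L t : admissible B X -> supersolution alpha B X L ->
  alpha * pr (hits_before (Z X) L t) <= leftlim L t.
Proof.
move=> [mX _] [ML sL]; have rL := Mspace_rcnd ML.
apply/ler_addgt0Pr => e e0; have e0' : 0 < e / alpha by rewrite divr_gt0.
have [m n mn|w|n] := pr_inc P e0' (hits_before_measurable t mX rL)
  (fun n => hits_measurable bB 0 (t - n.+1%:R^-1) mX rL).
- move=> w [s /andP[s0 st] zs]; exists s => //.
  by rewrite s0 (le_trans st)// lerD2l lerN2 invSn_le.
- move=> [s /andP[s0 st] zs]; have [n Hn] := invSn_small (ltac:(lra) : 0 < t - s).
  by exists n => //; exists s => //; rewrite s0/=; move: (_^-1) Hn => c Hn; lra.
rewrite -(ltr_pM2l alpha0) mulrBr (mulrC _ (e / alpha)) divfK ?gt_eqF//.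
rewrite -GammaE// => Hn.
have nt : t - n.+1%:R^-1 < t by rewrite ltrBlDr ltrDl invSn_gt0.
suff : Gam X L (t - n.+1%:R^-1) <= leftlim L t by lra.
apply: le_trans (leftlim_ge rL.1 nt).
have [t0|t0] := leP 0 (t - n.+1%:R^-1); first exact: sL.
by rewrite (Mspace_lt0 ML t0) (Mspace_lt0 (Gamma_Mspace alpha0 bB mX rL) t0).
Qed.

(** If the jump fell short of the physical size by y0, the actual jump would account for only part
    of the exposed mass. Survivors within y < y0 of the boundary would then have mass at least y /
    alpha, which [instantaneous_loss] excludes. *)
Lemma jump_ge_physical X L t : admissible B X -> solution P alpha B X L ->
  0 <= t -> physical_jump X L t <= L t - leftlim L t.
Proof.
move=> aX sL t0; have [mX iX] := aX; have rL := Mspace_rcnd sL.1.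
rewrite leNgt; apply/negP => dD.
have d0 := leftlim_le_at t rL.1.
have y00 : 0 < physical_jump X L t - (L t - leftlim L t) by lra.
have solE s : 0 <= s -> L s = alpha * pr (hits (Z X) L 0 s).
  by move=> s0; rewrite sL.2// GammaE.
apply: (instantaneous_loss bB mX iX rL alpha0 t0 y00); last first.
  by move=> s ts; apply: solE; lra.
move=> y /andP[y0 yD].
have := @below_physical_jump X L t (L t - leftlim L t + y) aX rL ltac:(lra) ltac:(lra).
set E := exposed _ _ _ _ => xE.
have mH := hits_measurable bB 0 t mX rL.
have mHb := hits_before_measurable t mX rL.
have mN : measurable (~` hits (Z X) L 0 t `&` [set w | Z X t w <= L t + y]).
  by apply: measurableI; [exact: measurableC|exact: particle_le_measurable].
have h1 : pr E <= pr (hits (Z X) L 0 t `\` hits_before (Z X) L t) +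
    pr (~` hits (Z X) L 0 t `&` [set w | Z X t w <= L t + y]).
  apply: pr_cover => //; [exact: exposed_measurable|exact: measurableD|].
  move=> w [Hw /= Zw]; have [|] := pselect (hits (Z X) L 0 t w); first by left.
  by right; split => //=; lra.
have h2 : pr (hits (Z X) L 0 t `\` hits_before (Z X) L t) + pr (hits_before (Z X) L t)
    <= pr (hits (Z X) L 0 t).
  rewrite -pr_disjU//; [|exact: measurableD|by apply/seteqP; split => // w [[]]].
  apply: pr_le => //; first by apply: measurableU => //; exact: measurableD.
  move=> w [[]//|[s /andP[s0 st] zs]]; exists s => //.
  by rewrite s0 ltW.
have h3 := hits_before_ge t aX sL.
have h4 := solE t t0.
move: h1 h2; rewrite -(ler_pM2l alpha0) mulrDr => h1.
rewrite -(ler_pM2l alpha0) mulrDr => h2; lra.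
Qed.

(* If the jump of [K] at [t] exceeded [x], the paths [Ls n] before [t - h],
   continued by the constant [leftlim K t + x] until [t + h], would be
   supersolutions for large [n]. *)
Lemma limit_jump_le X (K : R -> R) (Ls : nat -> R -> R) (eps : nat -> R) t x :
  admissible B X -> supersolution alpha B X K ->
  (forall m n, (m <= n)%N -> eps n <= eps m) ->
  (forall e, 0 < e -> exists n, eps n <= e) ->
  (forall n, solution P alpha B (fun w => X w - eps n) (Ls n)) ->
  (forall n l s, supersolution alpha B (fun w => X w - eps n) l -> Ls n s <= l s) ->
  (forall m n s, (m <= n)%N -> Ls n s <= Ls m s) ->
  (forall n s, K s <= Ls n s) ->
  (forall s e, 0 < e -> exists n, Ls n s < K s + e) ->
  0 <= t -> 0 < x -> alpha * pr (exposed X K t x) < x ->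
  K t <= leftlim K t + x.
Proof.
move=> aX sK epsm eps0 solL minL Lm KL LK t0 x0 ex.
have [mX iX] := aX; have rK := Mspace_rcnd sK.1.
rewrite leNgt; apply/negP; set c := leftlim K t + x => Kc.
have lK0 : 0 <= leftlim K t.
  apply: le_trans (leftlim_ge rK.1 (_ : t - 1 < t)); last lra.
  exact: Mspace_ge0 sK.1.
have rc := rcnd_cst c.
have rL n := Mspace_rcnd (solL n).1.
pose Zn n := Z (fun w => X w - eps n).
have aXn n : admissible B (fun w => X w - eps n) by exact: admissible_shift.
have mHb := hits_before_measurable t mX rK.
(* These events decrease to the exposed set: meeting the level c in windows shrinking to t forces Z
   t <= c. *)
pose U k := ~` hits_before (Z X) K t `&`
  hits (Z X) (cst c) (Num.max 0 (t - k.+1%:R^-1)) (t + k.+1%:R^-1).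
have mU k : measurable (U k).
  by apply: measurableI; [exact: measurableC|exact: hits_measurable].
have [e0 eE] : exists2 e, 0 < e & alpha * (pr (exposed X K t x) + e) < x.
  exists ((x - alpha * pr (exposed X K t x)) / alpha / 2).
    by rewrite !divr_gt0// subr_gt0.
  rewrite mulrDr (_ : alpha * (_ / alpha / 2) = (x - alpha * pr (exposed X K t x)) / 2); first lra.
  by rewrite mulrA (mulrC alpha) divfK// gt_eqF.
move=> exE.
have [||k Hk] := pr_dec P eE (exposed_measurable t x mX rK) mU.
- move=> m n mn w [Hw [s /andP[s0 st] zs]]; split => //; exists s => //.
  have := @invSn_le R _ _ mn => mn'; move: s0; rewrite !ge_max => /andP[-> s1] /=.
  by move: mn' st s1; move: (m.+1%:R^-1) (n.+1%:R^-1) => *; apply/andP; split; lra.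
- move=> w H; split; first by have [] := H 0%N I.
  rewrite /= leNgt; apply/negP => Zc.
  have e1 : 0 < Z X t w - c by rewrite /c; lra.
  have [r r0 Hr] := continuous_eps t (@particle_continuous _ _ _ P B bB X w) e1.
  have [n Hn] := invSn_small r0; have [_ [s /andP[s0 st] /= zs]] := H n I.
  move: s0; rewrite ge_max => /andP[s0 s1].
  move: st s1 Hn; move: (n.+1%:R^-1) => q st s1 Hn.
  have := Hr s; rewrite ltr_norml => /(_ ltac:(by apply/andP; split; lra)).
  by rewrite ltr_norml => /andP[h _]; rewrite /cst in zs; lra.
rewrite /U in Hk; set h : R := k.+1%:R^-1 in Hk; have h0 : 0 < h := invSn_gt0 k.
set t1 := Num.max 0 (t - h) in Hk.
have t1t : t1 <= t by rewrite ge_max t0/=; lra.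
have t10 : 0 <= t1 by rewrite le_max lexx.
(* Contains every hit of the spliced boundary at times before t + h, so alpha * P (V n) < c is the
   inequality to reach. *)
pose V n := hits (Zn n) (Ls n) 0 (t - h) `|` hits (Zn n) (cst c) t1 (t + h).
have mXn n : measurable_fun setT (fun w => X w - eps n) := (aXn n).1.
have mV n : measurable (V n).
  by apply: measurableU; apply: hits_measurable.
have mUk : measurable (~` hits_before (Z X) K t `&` hits (Z X) (cst c) t1 (t + h)).
  by apply: measurableI; [exact: measurableC|exact: hits_measurable].
have mA : measurable (hits_before (Z X) K t `|`
    (~` hits_before (Z X) K t `&` hits (Z X) (cst c) t1 (t + h))) by exact: measurableU.
have V1m m n : (m <= n)%N -> hits (Zn n) (Ls n) 0 (t - h) `<=` hits (Zn m) (Ls m) 0 (t - h).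
  move=> mn w [s sh zs]; exists s => //.
  have := Lm _ _ s mn; have := epsm _ _ mn; move: zs; rewrite /Zn /particle; lra.
have V2m m n : (m <= n)%N -> hits (Zn n) (cst c) t1 (t + h) `<=` hits (Zn m) (cst c) t1 (t + h).
  move=> mn w [s sh zs]; exists s => //.
  have := epsm _ _ mn; move: zs; rewrite /Zn /particle /cst; lra.
(* The budget for the limit event: hits before t cost at most [leftlim K t] and hits in the window
   less than x, together less than c. *)
have e1 : 0 < c / alpha - pr (hits_before (Z X) K t `|`
    (~` hits_before (Z X) K t `&` hits (Z X) (cst c) t1 (t + h))).
  rewrite subr_gt0 ltr_pdivlMr// mulrC.
  rewrite pr_disjU//; last by apply/seteqP; split => // w [? []].
  rewrite mulrDr; have := hits_before_le t aX sK.
  have : alpha * pr (~` hits_before (Z X) K t `&` hits (Z X) (cst c) t1 (t + h)) < x.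
    by apply: lt_trans exE; rewrite ltr_pM2l.
  by rewrite /c; lra.
have [||n1 Hn1] := pr_dec P e1 mA mV.
- by move=> m n mn w [/(V1m _ _ mn)|/(V2m _ _ mn)]; [left|right].
(* Both families decrease in n, so a path in every union lies in all the events of one family. *)
- move=> w H; have [H1|] := pselect (forall n, hits (Zn n) (Ls n) 0 (t - h) w).
    left; have [s /andP[s0 st] zs] : hits (Z X) K 0 (t - h) w.
      apply: (@limit_hit R (Z X ^~ w) Ls K eps 0 (t - h)) => //.
        exact: (@particle_continuous _ _ _ P B bB X w).
      move=> n; have [s sh zs] := H1 n; exists s => //.
      by move: zs; rewrite /Zn /particle; lra.
    by exists s => //; rewrite s0/=; lra.
  move=> /existsNP[n0 Hn0].
  have H2 n : hits (Zn n) (cst c) t1 (t + h) w.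
    have [/(V1m _ _ (leq_maxr n n0))//|] := H (maxn n n0) I.
    exact: V2m (leq_maxl n n0) _.
  have [Hb|Hb] := pselect (hits_before (Z X) K t w); [by left|right; split => //].
  apply: (@limit_hit R (Z X ^~ w) (fun=> cst c) (cst c) eps t1 (t + h)) => //.
  + exact: (@particle_continuous _ _ _ P B bB X w).
  + by move=> s e e_gt0; exists 0%N; rewrite ltrDl.
  + move=> n; have [s sh zs] := H2 n; exists s => //.
    by move: zs; rewrite /Zn /particle; lra.
rewrite addrC subrK ltr_pdivlMr// mulrC in Hn1.
(* Ensures that [Ls n] is at most K (t - h) + x <= c before the splice, so that the spliced function
   is nondecreasing. *)
have [n2 Hn2] := LK (t - h) x x0.
pose n := maxn n1 n2.
have Vn : alpha * pr (V n) < c.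
  apply: le_lt_trans Hn1; rewrite ler_pM2l//; apply: pr_le => //.
  by move=> w [/(V1m _ _ (leq_maxl n1 n2))|/(V2m _ _ (leq_maxl n1 n2))]; [left|right].
have Lc s : s < t1 -> Ls n s <= c.
  rewrite lt_max => /orP[s0|sh].
    by rewrite (Mspace_lt0 (solL n).1 s0) /c; lra.
  have th : t - h < t by lra.
  have := homo_leW (rL n).1 (ltW sh); have := Lm _ _ (t - h) (leq_maxr n1 n2).
  have := leftlim_ge rK.1 th; rewrite /c -/n; lra.
(* From t + h on the inequality is free, because Gamma never exceeds alpha. *)
pose g s := if s < t + h then c else c + alpha.
have rg : rcnd g.
  by apply: (rcnd_glue (f := cst c) (g := cst (c + alpha))) => //; [exact: rcnd_cst|move=> s _ /=; rewrite lerDl ltW].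
pose l s := if s < t1 then Ls n s else g s.
have t1h : t1 < t + h by lra.
have rl : rcnd l.
  by apply: rcnd_glue => // s st1; rewrite /g t1h; exact: Lc.
have Ml : Mspace l.
  apply/MspaceP; split => // s s0; rewrite /l (lt_le_trans s0 t10).
  exact: Mspace_lt0 (solL n).1 s0.
have : Ls n t <= l t.
  apply: minL; split => // s s0; rewrite {2}/l.
  case: ltP => st1.
    rewrite [leRHS](solutionE alpha0 bB _ (mXn n) (solL n)).
    apply: Gamma_le => // u w /andP[_ us].
    by rewrite /l (le_lt_trans us st1).
  rewrite /g; case: ltP => sth; last first.
    apply: le_trans (Gamma_le_alpha alpha0 bB s (mXn n) rl) _; rewrite /c; lra.
  rewrite GammaE//; apply: le_trans (ltW Vn); rewrite ler_pM2l//; apply: pr_le => //.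
    exact: hits_measurable.
  move=> w [u /andP[u0 us]]; rewrite {1}/l /g; case: ltP => ut1.
    move: ut1; rewrite lt_max ltNge u0/= => uh zu.
    by left; exists u => //; rewrite u0 ltW.
  rewrite (le_lt_trans us sth) => zu; right; exists u => //.
  by rewrite ut1/=; lra.
have -> : l t = c by rewrite /l ltNge t1t/= /g ifT//; lra.
by have := KL n t; lra.
Qed.

(** Look at the infimum u of the times where L' < L. A jump of L above L' at u contradicts the
    exposed mass; otherwise L <= L' + e shortly after u, and monotonicity of Gamma gives L <= L'
    there, so u is not the infimum. *)
Lemma solution_le_of_jump_le X L L' e : admissible B X ->
  solution P alpha B X L ->
  (forall t, 0 <= t -> L t - leftlim L t <= physical_jump X L t) ->
  0 < e -> solution P alpha B (fun w => X w - e) L' -> forall t, L t <= L' t.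
Proof.
move=> aX sL jL e0 sL' t.
have [mX iX] := aX; have aX' : admissible B (fun w => X w - e) by exact: admissible_shift.
have rL := Mspace_rcnd sL.1; have rL' := Mspace_rcnd sL'.1.
rewrite leNgt; apply/negP => Lt.
pose S := [set s | L' s < L s].
have S0 s : S s -> 0 <= s.
  move=> Ss; rewrite leNgt; apply/negP => s0; move: Ss.
  by rewrite /S/= (Mspace_lt0 sL.1 s0) (Mspace_lt0 sL'.1 s0) ltxx.
have hS : has_inf S by split; [exists t|exists 0].
pose u := inf S.
have u0 : 0 <= u by apply: lb_le_inf => //; exact: hS.1.
have Lu s : s < u -> L s <= L' s.
  move=> su; rewrite leNgt; apply/negP => Ss; move: su; apply/negP.
  by rewrite -leNgt; apply: ge_inf => //; exact: hS.2.
have lu : leftlim L u <= leftlim L' u.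
  apply: leftlim_le; first exact: rL.1.
  by move=> s su; apply: le_trans (Lu s su) _; apply: leftlim_ge => //; exact: rL'.1.
have lu' := leftlim_le_at u rL'.1.
have LuL : L u <= L' u.
  rewrite leNgt; apply/negP => Lu'.
  pose dl := L' u - leftlim L u; have dl0 : 0 <= dl by rewrite /dl; lra.
  have dD : dl < physical_jump X L u by have := jL u u0; rewrite /dl; lra.
  (* Slightly more than what L' reaches at u: still below the physical jump, so exposed mass at
     least x / alpha is available, and within the head start e, so all of it is hit by L'. *)
  pose x := Num.min (dl + e) ((dl + physical_jump X L u) / 2).
  have x1 : dl < x by rewrite lt_min; apply/andP; split; lra.
  have x2 : x <= dl + e by rewrite ge_min lexx.
  have x3 : x < physical_jump X L u by rewrite gt_min; apply/orP; right; lra.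
  have x00 : 0 < x by lra.
  have h1 := below_physical_jump aX rL x00 x3.
  have h2 := hits_before_ge u aX sL.
  have mHb := hits_before_measurable u mX rL.
  have mE := exposed_measurable u x mX rL.
  have h3 : pr (hits_before (Z X) L u) + pr (exposed X L u x) <=
      pr (hits (Z (fun w => X w - e)) L' 0 u).
    rewrite -pr_disjU//; last by apply/seteqP; split => // w [? []].
    apply: pr_le; [exact: measurableU|apply: hits_measurable => //; exact: aX'.1|].
    move=> w [[s /andP[s0 su] zs]|[_ /= zu]].
      exists s; first by rewrite s0 ltW.
      by have := Lu s su; move: zs; rewrite /particle; lra.
    exists u; first by rewrite u0 lexx.
    by move: zu x2; rewrite /dl /particle; lra.
  have := sL'.2 u u0; rewrite GammaE// => h4.
  have : alpha * (pr (hits_before (Z X) L u) + pr (exposed X L u x)) <= L' u.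
    by rewrite h4 ler_pM2l.
  by rewrite mulrDr; move: x1; rewrite /dl; lra.
have [r r0 Hr] := rL.2 u e e0.
have LL s : s <= u + r -> L s <= L' s + e.
  move=> sr; have [su|su] := ltP s u; first by have := Lu s su; lra.
  have := homo_leW rL.1 sr; have := homo_leW rL'.1 su; lra.
have [s Ss sr] := inf_adherent r0 hS; rewrite -/u in sr.
have s0 := S0 s Ss; move: Ss; apply/negP; rewrite -leNgt.
rewrite (solutionE alpha0 bB _ mX sL) (solutionE alpha0 bB _ aX'.1 sL').
apply: (Gamma_le alpha0 bB mX aX'.1 rL rL') => v w /andP[_ vs].
by have := LL v ltac:(lra); lra.
Qed.

End jumps.

(** * Perturbed initial conditions *)

Section shifted_minimal_solutions.
Context {R : realType} d (T : measurableType d) (P : probability T R).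
Variables (alpha : R) (B : R -> {RV P >-> R}) (X : T -> R).
Hypotheses (alpha0 : 0 < alpha) (bB : brownian_motion B) (aX : admissible B X).

Local Notation pr := (pr P).
Local Notation sol X L := (solution P alpha B X L).

(** One statement for two cases: the constant sequence with eps = 0 gives the minimal solution, and
    eps = 1 / (n + 1) gives the limit from the left. *)
Lemma limit_physical (K : R -> R) (Ls : nat -> R -> R) (eps : nat -> R) :
  sol X K ->
  (forall m n, (m <= n)%N -> eps n <= eps m) ->
  (forall e, 0 < e -> exists n, eps n <= e) ->
  (forall n, sol (fun w => X w - eps n) (Ls n)) ->
  (forall n l s, supersolution alpha B (fun w => X w - eps n) l -> Ls n s <= l s) ->
  (forall m n s, (m <= n)%N -> Ls n s <= Ls m s) ->
  (forall n s, K s <= Ls n s) ->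
  (forall s e, 0 < e -> exists n, Ls n s < K s + e) ->
  physical_solution P alpha B X K.
Proof.
move=> sK epsm eps0 solL minL Lm KL LK; apply/(physical_solutionP _ bB) => //.
split => // t t0; apply/eqP; rewrite eq_le jump_ge_physical// andbT.
rewrite leNgt; apply/negP => /(above_physical_jump alpha0 bB aX (Mspace_rcnd sK.1)).
move=> [x [x0 xj ex]].
have := limit_jump_le alpha0 bB aX (solution_supersolution sK) epsm eps0 solL minL Lm KL LK t0 x0 ex.
lra.
Qed.

(* [Lx x] is the minimal solution for [X + x], and [K] is the limit of [Lx x] as
   [x] increases to [0]. *)
Variables (Lx : R -> R -> R) (K : R -> R).
Hypothesis solx : forall x, sol (fun w => X w + x) (Lx x).
Hypothesis minx : forall x l t,
  supersolution alpha B (fun w => X w + x) l -> Lx x t <= l t.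
Hypothesis K_le : forall n t, K t <= Lx (- n.+1%:R^-1) t.
Hypothesis K_approx : forall t e, 0 < e -> exists n, Lx (- n.+1%:R^-1) t < K t + e.

Local Notation Kn := (fun n => Lx (- n.+1%:R^-1)).
Local Notation Jn := (fun n => Lx n.+1%:R^-1).

(** A solution for the lower initial condition is a supersolution for the higher one. *)
Lemma minimal_solution_shift_le x y t : x <= y -> Lx y t <= Lx x t.
Proof.
move=> xy; have Mx := (solx x).1; apply: minx; split => // s s0.
rewrite [leRHS](solx x).2//; apply: Gamma_le => //.
- exact: (admissible_shift y aX).1.
- exact: (admissible_shift x aX).1.
- exact: Mspace_rcnd.
- exact: Mspace_rcnd.
- by move=> u w _; rewrite lerB// lerD2l.
Qed.

Let X0E : (fun w => X w + 0) = X.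
Proof. by apply/funext => w; rewrite addr0. Qed.

Lemma minimal_solution_physical : physical_solution P alpha B X (Lx 0).
Proof.
have sX := solx 0; rewrite X0E in sX.
have E : (fun w => X w - 0) = X by apply/funext => w; rewrite subr0.
apply: (limit_physical (Ls := fun=> Lx 0) (eps := fun=> 0) sX).
- by [].
- by move=> e e0; exists 0%N; exact: ltW.
- by move=> _; rewrite E.
- by move=> _ l s; rewrite E -{1}X0E; exact: minx.
- by [].
- by [].
- by move=> s e e0; exists 0%N; rewrite ltrDl.
Qed.

Let Kn_le m n t : (m <= n)%N -> Kn n t <= Kn m t.
Proof. by move=> mn; apply: minimal_solution_shift_le; rewrite lerN2 invSn_le. Qed.

Let MKn n : Mspace (Kn n) := (solx _).1.

Let K_ge t c : (forall n, c <= Kn n t) -> c <= K t.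
Proof.
move=> H; rewrite leNgt; apply/negP => Kc.
have [n Hn] := K_approx t (ltac:(lra) : 0 < c - K t).
have := H n; lra.
Qed.

Let K_homo : {homo K : s t / s <= t}.
Proof.
move=> s t st; apply: K_ge => n; apply: le_trans (K_le n s) _.
exact: (Mspace_homo (MKn n)).
Qed.

Lemma left_limit_solution_Mspace : Mspace K.
Proof.
apply/MspaceP; split; last first.
  move=> t t0; apply/eqP; rewrite eq_le -{1}(Mspace_lt0 (MKn 0) t0) K_le/=.
  by apply: K_ge => n; exact: Mspace_ge0.
split=> [|t e e0]; first exact: K_homo.
have e2 : 0 < e / 2 by lra.
have [n Hn] := K_approx t e2; have [r r0 Hr] := (Mspace_rcnd (MKn n)).2 t _ e2.
by exists r => //; have := K_le n (t + r); lra.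
Qed.

(** The boundaries decrease here, so compactness carries the hits to the limit and no crossing
    argument is involved. *)
Lemma left_limit_solution_solution : sol X K.
Proof.
have [mX iX] := aX; have MK := left_limit_solution_Mspace; have rK := Mspace_rcnd MK.
have rKn n := Mspace_rcnd (MKn n).
have mXn n : measurable_fun setT (fun w => X w + - n.+1%:R^-1) :=
  (admissible_shift _ aX).1.
split => // t t0; apply/eqP; rewrite eq_le; apply/andP; split; last first.
  apply: K_ge => n; rewrite [leRHS](solx _).2//.
  apply: (Gamma_le alpha0 bB mX (mXn n) rK (rKn n)) => s w _.
  have := K_le n s; have := @invSn_gt0 R n; move: (_^-1) => q; lra.
apply/ler_addgt0Pr => e e0; have e0' : 0 < e / alpha by rewrite divr_gt0.
have [m n mn w|w H|n] := pr_dec P e0' (hits_measurable bB 0 t mX rK)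
    (fun n => hits_measurable bB 0 t (mXn n) (rKn n)).
- move=> [s st zs]; exists s => //; have := Kn_le s mn.
  by move: zs (@invSn_le R _ _ mn); rewrite /particle; move: (m.+1%:R^-1 : R) (n.+1%:R^-1 : R) => p q; lra.
- apply: (@limit_hit R (particle X B ^~ w) Kn K (fun n => n.+1%:R^-1)) => //.
  + exact: (@particle_continuous _ _ _ P B bB X w).
  + exact: invSn_le.
  + by move=> c /invSn_small[n /ltW ?]; exists n.
  + move=> n; have [s st zs] := H n I; exists s => //.
    by move: zs; rewrite /particle; move: (_^-1) => q; lra.
rewrite -(ltr_pM2l alpha0) mulrDr (mulrC _ (e / alpha)) divfK ?gt_eqF//.
rewrite -!GammaE// -(solx _).2// => /ltW; apply: le_trans; exact: K_le.
Qed.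

Lemma left_limit_solution_physical : physical_solution P alpha B X K.
Proof.
apply: (limit_physical (Ls := Kn) (eps := fun n => n.+1%:R^-1) left_limit_solution_solution).
- exact: invSn_le.
- by move=> c /invSn_small[n /ltW ?]; exists n.
- by move=> n; exact: solx.
- by move=> n l s; exact: minx.
- by move=> m n s; exact: Kn_le.
- by move=> n s; exact: K_le.
- by move=> s e; exact: K_approx.
Qed.

Lemma left_limit_solution_wcvg : wcvg Kn K.
Proof.
move=> t e e0; have [N HN] := K_approx t e0; exists N => n Nn.
have := Kn_le t Nn; have := K_le n t.
have := @homo_leW _ K (t - e) t K_homo ltac:(lra).
have := @homo_leW _ K t (t + e) K_homo ltac:(lra).
by move=> *; apply/andP; split; lra.
Qed.

Lemma physical_solution_between L t : physical_solution P alpha B X L ->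
  Lx 0 t <= L t <= K t.
Proof.
move=> /(physical_solutionP _ bB) -/(_ aX)[sL jL]; apply/andP; split.
  by apply: minx; rewrite X0E; exact: solution_supersolution.
apply: K_ge => n; apply: (solution_le_of_jump_le alpha0 bB aX sL _ (@invSn_gt0 R n)).
  by move=> s s0; rewrite jL.
exact: solx.
Qed.

Let Jn_le m n t : (m <= n)%N -> Jn m t <= Jn n t.
Proof. by move=> mn; apply: minimal_solution_shift_le; rewrite invSn_le. Qed.

Let MJn n : Mspace (Jn n) := (solx _).1.

Let Jn_le_alpha n t : Jn n t <= alpha.
Proof.
have aXn := admissible_shift n.+1%:R^-1 aX.
rewrite (solutionE alpha0 bB t aXn.1 (solx _)).
by apply: Gamma_le_alpha => //; [exact: aXn.1|exact: Mspace_rcnd (MJn n)].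
Qed.

Lemma minimal_solution_le_right_limit t : Lx 0 t <= right_reg (sup_seq Jn) t.
Proof.
apply: minx; rewrite X0E.
apply: (increasing_limit_supersolution alpha0 bB (ls := Jn) (eps := fun n => n.+1%:R^-1)) => //.
- exact: invSn_le.
- by move=> c /invSn_small[n /ltW ?]; exists n.
- by move=> s c; exact: sup_seq_approx Jn_le_alpha s c.
- exact: sup_seq_homo MJn Jn_le_alpha.
- exact: sup_seq_lt0 MJn Jn_le_alpha.
- by move=> n t' t0; rewrite -(solx _).2//; exact: sup_seq_ge Jn_le_alpha n t'.
Qed.

Lemma continuous_minimal_solution : Lx 0 = K ->
  M1_continuous_at Lx 0.
Proof.
move=> LK x x0; apply: wcvg_M1_cvg => [n||t e e0]; [exact: (solx _).1|exact: (solx _).1|].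
have [N1 H1] := K_approx t e0.
have [N2 H2] := sup_seq_approx Jn_le_alpha t e0.
(* Once |x n| < r, monotonicity in the shift squeezes [Lx (x n)] between [Jn N2] and [Kn N1],
   whatever the sign of x n. *)
pose r : R := Num.min N1.+1%:R^-1 N2.+1%:R^-1.
have r0 : 0 < r by rewrite lt_min !invSn_gt0.
have /cvgrPdist_lt/(_ r r0)[N _ HN] := x0.
exists N => n /HN /=; rewrite sub0r normrN ltr_norml => /andP[x1 x2].
have r1 : r <= N1.+1%:R^-1 by rewrite ge_min lexx.
have r2 : r <= N2.+1%:R^-1 by rewrite ge_min lexx orbT.
have L1 : Lx (x n) t <= Kn N1 t.
  by apply: minimal_solution_shift_le; move: r1; move: (_^-1) => q; lra.
have L2 : Jn N2 t <= Lx (x n) t.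
  by apply: minimal_solution_shift_le; move: r2; move: (_^-1) => q; lra.
have h1 := minimal_solution_le_right_limit (t - e).
have h2 : right_reg (sup_seq Jn) (t - e) <= sup_seq Jn t.
  by apply: right_reg_le; [exact: sup_seq_homo MJn Jn_le_alpha|lra].
have h3 := @homo_leW _ K t (t + e) K_homo ltac:(lra).
have LKt : Lx 0 (t + e) = K (t + e) by rewrite LK.
by rewrite LKt; apply/andP; split; lra.
Qed.

Lemma continuous_minimal_solution_left : M1_continuous_at Lx 0 -> Lx 0 = K.
Proof.
move=> H; apply: (M1_cvg_unique MKn left_limit_solution_Mspace left_limit_solution_wcvg).
  by have [] := (solx 0).1.
apply: (H (fun n => - n.+1%:R^-1)); apply/cvgrPdist_lt => e e0.
have [N HN] := invSn_small e0; exists N => // n /= Nn.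
rewrite sub0r opprK gtr0_norm ?invSn_gt0//.
by apply: le_lt_trans HN; exact: invSn_le.
Qed.

Lemma continuous_iff_unique_physical :
  M1_continuous_at Lx 0 <-> exists! L, physical_solution P alpha B X L.
Proof.
split=> [/continuous_minimal_solution_left LK|[L [_ uL]]].
  exists (Lx 0); split; first exact: minimal_solution_physical.
  move=> L /physical_solution_between pL; apply/funext => t; apply/eqP.
  by rewrite eq_le; move: (pL t); rewrite -LK.
apply: continuous_minimal_solution.
by rewrite -(uL _ minimal_solution_physical) -(uL _ left_limit_solution_physical).
Qed.

End shifted_minimal_solutions.

Lemma inf_seq_approx (R : realType) (f : nat -> R) (c : R) :
  (forall n, c <= f n) ->
  (forall n, inf (range f) <= f n) /\
  (forall e, 0 < e -> exists n, f n < inf (range f) + e).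
Proof.
move=> cf; have hf : has_inf (range f).
  by split; [exists (f 0%N), 0%N|exists c => _ [n _ <-]].
split=> [n|e e0]; first by apply: ge_inf; [exact: hf.2|exists n].
by have [_ [n _ <-] Hn] := inf_adherent e0 hf; exists n.
Qed.

Theorem mainTheorem5 (R : realType) (d : measure_display)
    (T : measurableType d) (P : probability T R)
    (alpha : R) (X0 : {RV P >-> R}) (B : R -> {RV P >-> R})
    (alpha_gt0 : 0 < alpha)
    (B_brownian : brownian_motion B)
    (X0_B_independent : independent_of_process P X0 B)
    (X0_integrable : ('E_P[fun w => `|X0 w|%R] < +oo)%E) :
  M1_continuous_at
    (fun x => minimal_solution P alpha B (fun w => X0 w + x)) 0
  <-> exists! L : R -> R, physical_solution P alpha B X0 L.
Proof.
have aX : admissible B X0 by split => //; exact: measurable_funP.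
pose Lx x := minimal_solution P alpha B (fun w => X0 w + x).
have aXx x := admissible_shift x aX.
have solx x : solution P alpha B (fun w => X0 w + x) (Lx x).
  exact: minimal_solution_solution.
(* The limit from the left is realized as a pointwise infimum, bounded below by 0. *)
have K_inf t := inf_seq_approx (fun n => Mspace_ge0 t (solx (- n.+1%:R^-1)).1).
apply: (continuous_iff_unique_physical alpha_gt0 B_brownian aX solx
  (K := fun t => inf (range (fun n => Lx (- n.+1%:R^-1) t)))).
- by move=> x l t; exact: minimal_solution_le.
- by move=> n t; exact: (K_inf t).1.
- by move=> t e; exact: (K_inf t).2.
Qed.
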